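(* Let $f:\mathbb{Z}_{\geq 1}\to\mathbb{C}$ be an arithmetic function such that $f(n)\ll n^{\alpha}$ for all $n\geq 1$, for some fixed $\alpha\in[0,1)$. For $x\geq 2$ define \[ T_f(x)=\sum_{n_1n_2\leq x} f\left(\left\lfloor \frac{x}{n_1n_2}\right\rfloor\right)=\sum_{n\leq x} f\left(\left\lfloor \frac{x}{n}\right\rfloor\right)\tau(n), \] where the first sum is over pairs of positive integers $(n_1,n_2)$ and $\tau(n)$ is the number of positive divisors of $n$. Put \[ C_1(f)=\sum_{d\geq 1}\frac{f(d)}{d(d+1)},\qquad C_3(f)=\sum_{d\geq 1} f(d)\left(\frac{\log d}{d}-\frac{\log(d+1)}{d+1}\right),\qquad C_2(f)=(2\gamma-1)C_1(f)-C_3(f), \] where $\gamma$ is Euler's constant (both series converge since $\alpha<1$). Then for every $\varepsilon>0$ and all $x\geq 2$, \[ T_f(x)=C_1(f)\,x\log x+C_2(f)\,x+O\left(x^{\frac{4+3\alpha}{7}+\varepsilon}\right), \] where the implied constant depends on $f$, $\alpha$ and $\varepsilon$.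
   Context: $\lfloor t\rfloor$ denotes the largest integer not exceeding $t$. *)

(* Defs.v *)
From Stdlib Require Import Reals List.
From Coquelicot Require Import Coquelicot.
Open Scope R_scope.

Definition csum (lo len : nat) (F : nat -> C) : C :=
  fold_right Cplus (RtoC 0) (map F (seq lo len)).

Definition nfloor (t : R) : nat := Z.to_nat (Int_part t).

(* T_f(x) = sum over pairs (n1,n2) of positive integers with n1 n2 <= x
   of f(floor(x/(n1 n2))).  For n1 <= x, the admissible n2 are 1..floor(x/n1). *)
Definition T_f (f : nat -> C) (x : R) : C :=
  csum 1 (nfloor x) (fun n1 =>
    csum 1 (nfloor (x / INR n1)) (fun n2 =>
      f (nfloor (x / (INR n1 * INR n2))))).

Definition euler_gamma : R :=
  real (Lim_seq (fun N => sum_f_R0 (fun k => / INR (S k)) N - ln (INR (S N)))).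

(* Main.v *)
(** Only [X = floor x] matters. Pairs with [n1 n2 <= X^(4/7)], about, are estimated
    trivially; the others are grouped by the value [d = floor (X / (n1 n2)) <= M],
    [M ~ X^(3/7)], so that the divisor sum [D u = sum_(n <= u) floor (u/n)] enters through
    [D (X/d) - D (X/(d+1))]. Its main term [u log u + (2 gamma - 1) u] produces [C1] and
    [C3], with series tails of size [M^(alpha - 1)], and what remains is
    [sum_(d <= M) |Delta (X/d)| << X^(4/7) log^4 X] for the divisor error term [Delta].

    For this, the hyperbola method writes [Delta] as a sum of sawtooth functions with
    moduli up to [sqrt u]; their finite Fourier expansions and the bound
    [min (Y, 1/|sin|)] for geometric sums give
    [sum_(u <= Y) Delta(u)^2 << Y^(3/2) log^3 Y]. As [D] is nondecreasing, [Delta]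
    changes slowly in one direction, so [|Delta (X/d)|] is at most [H log X] plus an
    average of [Delta^2 / H] over a window of length [H] about [X/d]. For [d] in a dyadic
    block at [D] and [H ~ X^(4/7)/D] these windows are disjoint, and the mean square
    bounds the block by [X^(4/7) log^3 X]. *)

Require Import Defs.
From Stdlib Require Import Reals List Lra Lia ZArith.
From Coquelicot Require Import Coquelicot.
Open Scope R_scope.

(** Several costs balance at [M ~ X^(3/7)]. The trivially estimated range has length [X/M]. Windows
    of length [H] about the points [X/d], [d ~ D], are disjoint only if [H] is below about [X/D^2];
    for [H = X^(4/7)/D] this reads [D < X^(3/7)]. A block costs [D H = X^(4/7)] for the width of the
    windows and [H^(-2) (X/D)^(3/2) = D^(1/2) X^(5/14)] for the mean square, and the latter reaches
    [X^(4/7)] exactly at [D = X^(3/7)]. Writing [X = q^7] makes these exponents integral.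

    The obstacle in the mean square is resonance between the fractions [h/m] and [k/n], the diagonal
    included. Over the common denominator [m n] the numerators [h n - k m] and [h n + k m] are
    affine in [n], and for [h < m] their distance to a multiple [j m n] has slope at least [1] in
    absolute value. So for fixed [m], [h], [k] all resonances together cost one logarithm. Summing
    over [n] with the frequencies fixed requires Fourier coefficients bounded in terms of [h] alone,
    which explains the weighted form of the expansion. Powers of the logarithm are spent freely,
    since [x^eps] absorbs them. *)

(** * Sums over [1..n] *)

Fixpoint rsum (n : nat) (F : nat -> R) : R :=
  match n with O => 0 | S m => rsum m F + F (S m) end.

Lemma rsum_ext n F G :
  (forall i, (1 <= i <= n)%nat -> F i = G i) -> rsum n F = rsum n G.
Proof.
  induction n as [|n IH]; simpl; intros H; [easy|].
  rewrite IH, H; auto; intros; try apply H; lia.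
Qed.

Lemma rsum_le n F G :
  (forall i, (1 <= i <= n)%nat -> F i <= G i) -> rsum n F <= rsum n G.
Proof.
  induction n as [|n IH]; simpl; intros H; [lra|].
  apply Rplus_le_compat; [apply IH; intros|]; apply H; lia.
Qed.

Lemma rsum_plus n F G : rsum n (fun i => F i + G i) = rsum n F + rsum n G.
Proof. induction n; simpl; [|rewrite IHn]; ring. Qed.

Lemma rsum_minus n F G : rsum n (fun i => F i - G i) = rsum n F - rsum n G.
Proof. induction n; simpl; [|rewrite IHn]; ring. Qed.

Lemma rsum_scal n c F : rsum n (fun i => c * F i) = c * rsum n F.
Proof. induction n; simpl; [|rewrite IHn]; ring. Qed.

Lemma rsum_const n c : rsum n (fun _ => c) = INR n * c.
Proof. induction n; [simpl; ring|]. rewrite S_INR; simpl; rewrite IHn; ring. Qed.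

Lemma rsum_0 n F : (forall i, (1 <= i <= n)%nat -> F i = 0) -> rsum n F = 0.
Proof. intros H. rewrite (rsum_ext n F (fun _ => 0) H), rsum_const; ring. Qed.

Lemma rsum_ge0 n F : (forall i, (1 <= i <= n)%nat -> 0 <= F i) -> 0 <= rsum n F.
Proof.
  intros H. rewrite <- (rsum_0 n (fun _ => 0)) by easy. now apply rsum_le.
Qed.

Lemma rsum_abs n F : Rabs (rsum n F) <= rsum n (fun i => Rabs (F i)).
Proof.
  induction n; simpl; [rewrite Rabs_R0; lra|].
  eapply Rle_trans; [apply Rabs_triang|lra].
Qed.

Lemma rsum_swap n m (F : nat -> nat -> R) :
  rsum n (fun i => rsum m (fun j => F i j)) = rsum m (fun j => rsum n (fun i => F i j)).
Proof.
  induction n; simpl; [symmetry; now apply rsum_0|].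
  rewrite IHn, <- rsum_plus. now apply rsum_ext.
Qed.

Lemma rsum_first n F : rsum (S n) F = F 1%nat + rsum n (fun i => F (S i)).
Proof.
  induction n; [simpl; ring|].
  change (rsum (S (S n)) F) with (rsum (S n) F + F (S (S n))).
  rewrite IHn; simpl; ring.
Qed.

Lemma rsum_rev n F : rsum n F = rsum n (fun i => F (S n - i)%nat).
Proof.
  induction n; [easy|].
  symmetry. rewrite rsum_first. simpl rsum at 2. rewrite IHn, Rplus_comm. easy.
Qed.

Lemma rsum_mono n m F :
  (n <= m)%nat -> (forall i, (1 <= i <= m)%nat -> 0 <= F i) -> rsum n F <= rsum m F.
Proof.
  intros Hnm; induction Hnm as [|m Hnm IH]; intros H; [lra|].
  simpl. assert (0 <= F (S m)) by (apply H; lia).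
  assert (rsum n F <= rsum m F) by (apply IH; intros; apply H; lia). lra.
Qed.

Lemma rsum_extend n m F :
  (n <= m)%nat -> (forall i, (n < i <= m)%nat -> F i = 0) -> rsum n F = rsum m F.
Proof.
  intros Hnm; induction Hnm as [|m Hnm IH]; intros H; [easy|].
  simpl. rewrite H by lia. rewrite IH; [ring|]. intros; apply H; lia.
Qed.

Lemma rsum_mult n m F G :
  rsum n F * rsum m G = rsum n (fun i => rsum m (fun j => F i * G j)).
Proof.
  rewrite Rmult_comm, <- rsum_scal. apply rsum_ext; intros.
  rewrite rsum_scal; ring.
Qed.

(** * Harmonic sums and bounds for the logarithm *)

Definition harm (n : nat) : R := rsum n (fun i => / INR i).

Lemma INR_ge1 n : (1 <= n)%nat -> 1 <= INR n.
Proof. intros H. apply (le_INR 1 n) in H. simpl in H. lra. Qed.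

Lemma harm_ge0 n : 0 <= harm n.
Proof.
  apply rsum_ge0; intros i Hi. left; apply Rinv_0_lt_compat.
  assert (1 <= INR i) by (apply INR_ge1; lia). lra.
Qed.

Lemma harm_mono n m : (n <= m)%nat -> harm n <= harm m.
Proof.
  intros H; apply rsum_mono; [easy|]. intros i Hi.
  left; apply Rinv_0_lt_compat. assert (1 <= INR i) by (apply INR_ge1; lia); lra.
Qed.

Lemma one_sub_inv_le_ln t : 0 < t -> 1 - / t <= ln t.
Proof.
  intros Ht. assert (H := exp_ineq1_le (- ln t)).
  rewrite exp_Ropp, exp_ln in H by easy. lra.
Qed.

Lemma ln_le_sub_one t : 0 < t -> ln t <= t - 1.
Proof.
  intros Ht. assert (H := exp_ineq1_le (ln t)). rewrite exp_ln in H by easy. lra.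
Qed.

Lemma ln_ge0 t : 1 <= t -> 0 <= ln t.
Proof. intros H. rewrite <- ln_1. apply ln_le; lra. Qed.

Lemma harm_le_ln n : (1 <= n)%nat -> harm n <= 1 + ln (INR n).
Proof.
  induction n as [|n IH]; [lia|]. intros _.
  destruct (Nat.eq_dec n 0) as [->|Hn].
  - unfold harm; simpl. rewrite ln_1. lra.
  - assert (Hn1 : 1 <= INR n) by (apply INR_ge1; lia).
    assert (IH' := IH ltac:(lia)).
    unfold harm in *; change (rsum (S n) ?F) with (rsum n F + F (S n)); cbv beta.
    assert (H := one_sub_inv_le_ln (INR (S n) / INR n)).
    rewrite S_INR in *. rewrite ln_div in H by lra.
    assert (E : 1 - / ((INR n + 1) / INR n) = / (INR n + 1)) by (field; lra).
    rewrite E in H. specialize (H ltac:(apply Rdiv_lt_0_compat; lra)). lra.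
Qed.

(** On either side of [t] the distances dominate [0, 1, 2, ...], so each side costs at most one
    harmonic sum, wherever [t] lies. *)
Lemma harm_abs_dist_le R0 t : rsum R0 (fun n => / (1 + Rabs (INR n - t))) <= 2 * harm R0.
Proof.
  assert (Hi : forall n s, 0 < s -> (1 <= n)%nat -> INR n <= s -> / s <= / INR n).
  { intros n s Hs Hn H. apply Rinv_le_contravar; [|easy].
    assert (1 <= INR n) by now apply INR_ge1. lra. }
  pose (lo t n := if Rle_dec (INR n) t then / (1 + (t - INR n)) else 0).
  pose (hi t n := if Rle_dec (INR n) t then 0 else / (1 + (INR n - t))).
  assert (Hlo : forall m t, rsum m (lo t) <= harm m).
  { induction m as [|m IH]; intros s; [unfold harm; simpl; lra|].
    destruct (Rle_dec (INR (S m)) s) as [H|H].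
    - unfold harm. rewrite (rsum_rev (S m) (fun i => / INR i)). apply rsum_le; intros i Hii.
      assert (Hile : INR i <= INR (S m)) by (apply le_INR; lia).
      unfold lo. destruct (Rle_dec (INR i) s); [|lra].
      apply Hi; [lra|lia|]. rewrite minus_INR by lia. rewrite (S_INR (S m)). lra.
    - simpl rsum. unfold lo at 2. destruct (Rle_dec (INR (S m)) s); [lra|].
      assert (harm m <= harm (S m)) by (apply harm_mono; lia). specialize (IH s). lra. }
  assert (Hhi : forall m t, rsum m (hi t) <= harm m).
  { induction m as [|m IH]; intros s; [unfold harm; simpl; lra|].
    destruct (Rle_dec (INR 1) s) as [H|H].
    - rewrite rsum_first. unfold hi at 1. destruct (Rle_dec (INR 1) s); [|lra].
      rewrite (rsum_ext m _ (hi (s - 1))).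
      + specialize (IH (s - 1)). assert (harm m <= harm (S m)) by (apply harm_mono; lia). lra.
      + intros i _. unfold hi. rewrite S_INR.
        destruct (Rle_dec (INR i + 1) s), (Rle_dec (INR i) (s - 1)); try lra.
        f_equal; lra.
    - apply rsum_le; intros i Hii.
      assert (1 <= INR i) by (apply INR_ge1; lia). simpl in H.
      unfold hi. destruct (Rle_dec (INR i) s); [lra|]. apply Hi; [lra|lia|lra]. }
  rewrite (rsum_ext _ _ (fun n => lo t n + hi t n)).
  - rewrite rsum_plus. specialize (Hlo R0 t). specialize (Hhi R0 t). lra.
  - intros i _. unfold lo, hi. destruct (Rle_dec (INR i) t).
    + rewrite Rabs_left1 by lra. rewrite Rplus_0_r. f_equal; lra.
    + rewrite Rabs_right by lra. lra.
Qed.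

(** * The sine near multiples of [PI], and sums of cosines *)

(** Cubic Taylor minorant: [a = PI x] is at most [2], so [a - a^3/6 >= a/3 >= x], using only
    [3 <= PI <= 4]. *)
Lemma sin_PI_mul_ge x : 0 <= x <= 1 / 2 -> x <= sin (PI * x).
Proof.
  intros [H0 H1]. assert (Hpi := PI_4). assert (Hpi3 := PI2_3_2).
  assert (Ha : 0 <= PI * x) by nra. assert (Ha2 : PI * x <= 2) by nra.
  destruct (pre_sin_bound (PI * x) 0) as [H _]; [lra|lra|].
  unfold sin_approx, sin_term in H. simpl in H.
  set (a := PI * x) in *.
  assert (a - a * a * a / 6 <= sin a) by lra.
  assert (0 <= a * (2 - a) * (2 + a)) by (apply Rmult_le_pos; [apply Rmult_le_pos|]; lra).
  assert (3 * x <= a) by (unfold a; nra). lra.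
Qed.

(** Vanishing at both ends is the point: [1 - x] cancels the weight in [saw_coef], and [x = h/n]
    leaves [1/h]. *)
Lemma sin_PI_mul_ge_parabola x : 0 <= x <= 1 -> x * (1 - x) <= sin (PI * x).
Proof.
  intros H. destruct (Rle_dec x (1 / 2)) as [Hx|Hx].
  - assert (x <= sin (PI * x)) by (apply sin_PI_mul_ge; lra). nra.
  - assert (H' : 1 - x <= sin (PI * (1 - x))) by (apply sin_PI_mul_ge; lra).
    replace (PI * (1 - x)) with (PI - PI * x) in H' by ring.
    rewrite sin_PI_x in H'. nra.
Qed.

Lemma Rabs_sin_add_PI x : Rabs (sin (x + PI)) = Rabs (sin x).
Proof. rewrite neg_sin. apply Rabs_Ropp. Qed.

Lemma Rabs_sin_sub_PI x : Rabs (sin (x - PI)) = Rabs (sin x).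
Proof. rewrite <- (Rabs_sin_add_PI (x - PI)). f_equal; f_equal; ring. Qed.

Lemma Rabs_sin_PI_mul_ge x : Rabs x <= 1 / 2 -> Rabs x <= Rabs (sin (PI * x)).
Proof.
  intros H. destruct (Rle_dec 0 x) as [Hx|Hx].
  - rewrite Rabs_right in * by lra. rewrite (Rabs_right (sin _)).
    + apply sin_PI_mul_ge; lra.
    + assert (x <= sin (PI * x)) by (apply sin_PI_mul_ge; lra). lra.
  - rewrite Rabs_left in * by lra.
    assert (H' : - x <= sin (PI * - x)) by (apply sin_PI_mul_ge; lra).
    replace (PI * - x) with (- (PI * x)) in H' by ring. rewrite sin_neg in H'.
    rewrite Rabs_left1; lra.
Qed.

Lemma Rabs_sin_PI_mul_shift (x : R) : -1 <= x <= 2 ->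
  exists j : Z, (-1 <= j <= 2)%Z /\ Rabs (x - IZR j) <= Rabs (sin (PI * x)).
Proof.
  intros H.
  destruct (Rle_dec x (-1 / 2)); [|destruct (Rle_dec x (1 / 2));
    [|destruct (Rle_dec x (3 / 2))]].
  - exists (-1)%Z; split; [lia|].
    rewrite <- Rabs_sin_add_PI. replace (PI * x + PI) with (PI * (x - -1)) by ring.
    apply Rabs_sin_PI_mul_ge, Rabs_le; lra.
  - exists 0%Z; split; [lia|]. rewrite Rminus_0_r.
    apply Rabs_sin_PI_mul_ge, Rabs_le; lra.
  - exists 1%Z; split; [lia|].
    rewrite <- Rabs_sin_sub_PI. replace (PI * x - PI) with (PI * (x - 1)) by ring.
    apply Rabs_sin_PI_mul_ge, Rabs_le; lra.
  - exists 2%Z; split; [lia|].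
    rewrite <- Rabs_sin_sub_PI, <- Rabs_sin_sub_PI.
    replace (PI * x - PI - PI) with (PI * (x - 2)) by ring.
    apply Rabs_sin_PI_mul_ge, Rabs_le; lra.
Qed.

Lemma sin_diff_cos phi t : sin (t + phi) - sin (t - phi) = 2 * sin phi * cos t.
Proof. rewrite sin_plus, sin_minus; ring. Qed.

(** Multiplication by [2 sin phi] telescopes the sum. The lower limit [N] sits in the summand
    because waves of moduli [m] and [n] are both present only for [u >= max (m^2, n^2)]. *)
Lemma cos_sum_telescope phi N Y : (1 <= N)%nat ->
  2 * sin phi * rsum Y (fun u => if (N <=? u)%nat then cos ((2 * INR u + 1) * phi) else 0)
  = if (N <=? Y)%nat then sin (2 * INR (S Y) * phi) - sin (2 * INR N * phi) else 0.
Proof.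
  intros HN. induction Y as [|Y IH].
  - simpl. destruct (Nat.leb_spec N 0); [lia|ring].
  - change (rsum (S Y) ?F) with (rsum Y F + F (S Y)); cbv beta.
    rewrite Rmult_plus_distr_l, IH.
    destruct (Nat.leb_spec N Y), (Nat.leb_spec N (S Y)); try lia; [| |ring].
    + rewrite <- sin_diff_cos.
      replace ((2 * INR (S Y) + 1) * phi + phi) with (2 * INR (S (S Y)) * phi)
        by (rewrite (S_INR (S Y)); ring).
      replace ((2 * INR (S Y) + 1) * phi - phi) with (2 * INR (S Y) * phi) by ring. ring.
    + rewrite <- sin_diff_cos. replace N with (S Y) by lia.
      replace ((2 * INR (S Y) + 1) * phi + phi) with (2 * INR (S (S Y)) * phi)
        by (rewrite (S_INR (S Y)); ring).
      replace ((2 * INR (S Y) + 1) * phi - phi) with (2 * INR (S Y) * phi) by ring. ring.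
Qed.

(** Kept as a product because [sin phi] can vanish, as it does on the diagonal [h/m = k/n]; there
    only the trivial bound helps. *)
Lemma cos_sum_bound phi N Y : (1 <= N)%nat ->
  Rabs (sin phi)
  * Rabs (rsum Y (fun u => if (N <=? u)%nat then cos ((2 * INR u + 1) * phi) else 0)) <= 1.
Proof.
  intros HN. assert (H := cos_sum_telescope phi N Y HN).
  apply (f_equal Rabs) in H. rewrite !Rabs_mult, (Rabs_right 2) in H by lra.
  assert (Rabs (if (N <=? Y)%nat then sin (2 * INR (S Y) * phi) - sin (2 * INR N * phi)
     else 0) <= 2); [|lra].
  destruct (N <=? Y)%nat; [|rewrite Rabs_R0; lra].
  assert (A := SIN_bound (2 * INR (S Y) * phi)). assert (B := SIN_bound (2 * INR N * phi)).
  apply Rabs_le; lra.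
Qed.

Lemma cos_sum_trivial_bound phi N Y :
  Rabs (rsum Y (fun u => if (N <=? u)%nat then cos ((2 * INR u + 1) * phi) else 0)) <= INR Y.
Proof.
  eapply Rle_trans; [apply rsum_abs|]. rewrite <- (Rmult_1_r (INR Y)), <- rsum_const.
  apply rsum_le; intros i _. destruct (N <=? i)%nat.
  - apply Rabs_le. apply COS_bound.
  - rewrite Rabs_R0; lra.
Qed.

(** * Finite Fourier expansion of the sawtooth *)

Lemma sin_PI_frac_neq0 v n : (1 <= n)%nat -> (v mod n <> 0)%nat ->
  sin (PI * (INR v / INR n)) <> 0.
Proof.
  intros Hn Hv H. apply sin_eq_0_0 in H as [k Hk].
  assert (Hn1 := INR_ge1 n Hn). assert (Hpi := PI_RGT_0).
  assert (E : IZR (Z.of_nat v) = IZR k * IZR (Z.of_nat n)).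
  { rewrite <- !INR_IZR_INZ.
    assert (INR v / INR n = IZR k) by (apply (Rmult_eq_reg_l PI); lra).
    rewrite <- H. field; lra. }
  rewrite <- mult_IZR in E. apply eq_IZR in E.
  apply Hv. apply Nat2Z.inj. rewrite Nat2Z.inj_mod, E. simpl. apply Z_mod_mult.
Qed.

(** Orthogonality of characters modulo [n] with the term [h = 0] left out. When [n] does not divide
    [v], the factor [2 sin phi] is nonzero and telescopes the sum. *)
Lemma cos_character_sum n v : (1 <= n)%nat ->
  rsum (n - 1) (fun h => cos (PI * (2 * INR h * INR v / INR n)))
  = if (v mod n =? 0)%nat then INR n - 1 else -1.
Proof.
  intros Hn. assert (Hn1 := INR_ge1 n Hn). destruct (Nat.eqb_spec (v mod n) 0) as [H|H].
  - rewrite (rsum_ext _ _ (fun _ => 1)).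
    + rewrite rsum_const, minus_INR by lia. simpl; ring.
    + intros h _. assert (E := Nat.Div0.div_mod v n). rewrite H, Nat.add_0_r in E.
      set (q := (v / n)%nat) in E. rewrite E.
      replace (PI * (2 * INR h * INR (n * q) / INR n)) with (0 + 2 * INR (h * q) * PI)
        by (rewrite !mult_INR; field; lra).
      now rewrite cos_period, cos_0.
  - set (phi := PI * (INR v / INR n)).
    assert (Hs : sin phi <> 0) by now apply sin_PI_frac_neq0.
    assert (G : forall m, 2 * sin phi * rsum m (fun h => cos (PI * (2 * INR h * INR v / INR n)))
       = sin ((2 * INR m + 1) * phi) - sin phi).
    { induction m as [|m IH].
      - simpl. replace ((2 * 0 + 1) * phi) with phi by ring. ring.
      - change (rsum (S m) ?F) with (rsum m F + F (S m)); cbv beta.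
        rewrite Rmult_plus_distr_l, IH, <- sin_diff_cos.
        replace (PI * (2 * INR (S m) * INR v / INR n) + phi) with ((2 * INR (S m) + 1) * phi)
          by (unfold phi; field; lra).
        replace (PI * (2 * INR (S m) * INR v / INR n) - phi) with ((2 * INR m + 1) * phi)
          by (unfold phi; rewrite S_INR; field; lra). ring. }
    specialize (G (n - 1)%nat). rewrite minus_INR in G by lia.
    (* [2 n phi] is a multiple of [2 PI], so the telescoped difference is [-2 sin phi]. *)
    replace ((2 * (INR n - INR 1) + 1) * phi) with (- phi + 2 * INR v * PI) in G
      by (unfold phi; simpl; field; lra).
    rewrite sin_period, sin_neg in G.
    apply (Rmult_eq_reg_l (2 * sin phi)); [lra|lra].
Qed.

(* Normalised to have mean zero over a period in [u]. *)
Definition saw (n u : nat) : R :=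
  INR (u mod n) / INR n - (INR n - 1) / (2 * INR n).

Lemma saw_succ n u : (1 <= n)%nat ->
  saw n (S u) - saw n u = / INR n - if (S u mod n =? 0)%nat then 1 else 0.
Proof.
  intros Hn. assert (Hn1 := INR_ge1 n Hn). unfold saw.
  assert (Hm := Nat.mod_upper_bound u n ltac:(lia)).
  assert (Hm' := Nat.mod_upper_bound (S u) n ltac:(lia)).
  assert (E : (S u mod n = S (u mod n) mod n)%nat).
  { symmetry. exact (Nat.Div0.add_mod_idemp_r 1 u n). }
  destruct (Nat.eqb_spec (S u mod n) 0) as [H|H].
  - rewrite H. assert (Hlast : S (u mod n) = n).
    { destruct (Nat.eq_dec (S (u mod n)) n); [easy|].
      rewrite E, Nat.mod_small in H; lia. }
    assert (INR n = INR (u mod n) + 1) by (rewrite <- S_INR; now f_equal).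
    simpl. replace (INR (u mod n)) with (INR n - 1) by lra. field; lra.
  - destruct (Nat.eq_dec (S (u mod n)) n) as [H'|H'].
    + rewrite E, H', Nat.Div0.mod_same in H. easy.
    + rewrite E, Nat.mod_small, S_INR by lia. field; lra.
Qed.

Lemma sin_PI_frac_pos h n : (1 <= h < n)%nat -> 0 < sin (PI * (INR h / INR n)).
Proof.
  intros H. assert (1 <= INR h) by (apply INR_ge1; lia).
  assert (INR h < INR n) by (apply lt_INR; lia). assert (Hpi := PI_RGT_0).
  assert (0 < INR h / INR n < 1).
  { split; [apply Rdiv_lt_0_compat; lra|]. apply Rlt_div_l; lra. }
  apply sin_gt_0; nra.
Qed.

(** Induction on [u] replaces Fourier inversion. At [u = 0] every term of the sum is [1/(2n)]. From
    [u] to [S u] the difference of sines is a pure cosine, thanks to the shift [2u + 1], and the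
    character sum that results is [-n] times the jump in [saw_succ]. *)
Lemma saw_fourier n u : (1 <= n)%nat ->
  saw n u = - rsum (n - 1) (fun h =>
    sin (PI * (INR h * (2 * INR u + 1) / INR n)) / (2 * INR n * sin (PI * (INR h / INR n)))).
Proof.
  intros Hn. assert (Hn1 := INR_ge1 n Hn).
  induction u as [|u IH].
  - rewrite (rsum_ext _ _ (fun _ => / (2 * INR n))).
    + rewrite rsum_const, minus_INR by lia. unfold saw.
      rewrite Nat.Div0.mod_0_l. simpl. field; lra.
    + intros h Hh. assert (Hs := sin_PI_frac_pos h n ltac:(lia)).
      replace (INR h * (2 * INR 0 + 1) / INR n) with (INR h / INR n) by (simpl; field; lra).
      field; split; lra.
  - assert (Hd := saw_succ n u Hn). assert (Hc := cos_character_sum n (S u) Hn).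
    assert (G : rsum (n - 1) (fun h =>
        sin (PI * (INR h * (2 * INR (S u) + 1) / INR n)) / (2 * INR n * sin (PI * (INR h / INR n))))
      - rsum (n - 1) (fun h =>
        sin (PI * (INR h * (2 * INR u + 1) / INR n)) / (2 * INR n * sin (PI * (INR h / INR n))))
      = / INR n * rsum (n - 1) (fun h => cos (PI * (2 * INR h * INR (S u) / INR n)))).
    { rewrite <- rsum_minus, <- rsum_scal. apply rsum_ext; intros h Hh.
      assert (Hs := sin_PI_frac_pos h n ltac:(lia)).
      set (phi := PI * (INR h / INR n)) in *.
      assert (D := sin_diff_cos phi (PI * (2 * INR h * INR (S u) / INR n))).
      replace (PI * (2 * INR h * INR (S u) / INR n) + phi)
        with (PI * (INR h * (2 * INR (S u) + 1) / INR n)) in D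
        by (unfold phi; rewrite S_INR; field; lra).
      replace (PI * (2 * INR h * INR (S u) / INR n) - phi)
        with (PI * (INR h * (2 * INR u + 1) / INR n)) in D
        by (unfold phi; rewrite S_INR; field; lra).
      match goal with |- ?A / ?c - ?B / ?c = _ =>
        replace (A / c - B / c) with ((A - B) / c) by (unfold Rdiv; ring) end.
      rewrite D. field; lra. }
    rewrite Hc in G.
    destruct (S u mod n =? 0)%nat.
    + assert (/ INR n * (INR n - 1) = 1 - / INR n) by (field; lra). lra.
    + lra.
Qed.

Definition saw_coef (n h : nat) : R :=
  (1 - INR h / INR n) / (INR n * sin (PI * (INR h / INR n))).

(* The Fourier terms of [h] and [n - h] agree; averaging them with weights
   [1 - h/n] and [h/n] gives coefficients bounded by [1/h] uniformly in [n]. *)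
Lemma saw_fourier_coef n u : (1 <= n)%nat ->
  saw n u = - rsum (n - 1) (fun h => saw_coef n h * sin (PI * (INR h * (2 * INR u + 1) / INR n))).
Proof.
  intros Hn. assert (Hn1 := INR_ge1 n Hn). rewrite saw_fourier by easy. f_equal.
  set (t := fun h => sin (PI * (INR h * (2 * INR u + 1) / INR n))
                     / (2 * INR n * sin (PI * (INR h / INR n)))).
  assert (Hsym : forall h, (1 <= h <= n - 1)%nat -> t (n - h)%nat = t h).
  { intros h Hh. unfold t. rewrite minus_INR by lia.
    replace (PI * ((INR n - INR h) / INR n)) with (PI - PI * (INR h / INR n)) by (field; lra).
    rewrite sin_PI_x.
    replace (PI * ((INR n - INR h) * (2 * INR u + 1) / INR n))
      with (PI - PI * (INR h * (2 * INR u + 1) / INR n) + 2 * INR u * PI) by (field; lra).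
    now rewrite sin_period, sin_PI_x. }
  assert (Hrev : rsum (n - 1) (fun h => INR h * t h) = rsum (n - 1) (fun h => (INR n - INR h) * t h)).
  { rewrite rsum_rev. apply rsum_ext; intros h Hh.
    replace (S (n - 1) - h)%nat with (n - h)%nat by lia.
    now rewrite Hsym, minus_INR by lia. }
  assert (Hsum : rsum (n - 1) (fun h => INR h * t h) + rsum (n - 1) (fun h => (INR n - INR h) * t h)
     = INR n * rsum (n - 1) t).
  { rewrite <- rsum_plus, <- rsum_scal. apply rsum_ext; intros; ring. }
  rewrite (rsum_ext _ (fun h => saw_coef n h * _) (fun h => 2 * / INR n * ((INR n - INR h) * t h))).
  - rewrite rsum_scal.
    replace (rsum (n - 1) (fun h => (INR n - INR h) * t h)) with (INR n * rsum (n - 1) t / 2) by lra.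
    field; lra.
  - intros h Hh. assert (Hs := sin_PI_frac_pos h n ltac:(lia)).
    unfold saw_coef, t. field. split; lra.
Qed.

(** The parabola bound at [x = h/n]. Without the weight [1 - h/n] the coefficient would only be
    [O(1/(n - h))] near [h = n]. *)
Lemma saw_coef_bound n h : (1 <= h < n)%nat -> 0 <= saw_coef n h <= / INR h.
Proof.
  intros Hh. assert (Hs := sin_PI_frac_pos h n Hh).
  assert (H1 : 1 <= INR h) by (apply INR_ge1; lia).
  assert (H2 : INR h < INR n) by (apply lt_INR; lia).
  assert (Hx : 0 < INR h / INR n < 1).
  { split; [apply Rdiv_lt_0_compat; lra|]. apply Rlt_div_l; lra. }
  unfold saw_coef. split.
  - apply Rmult_le_pos; [lra|]. left; apply Rinv_0_lt_compat. nra.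
  - assert (Hp := sin_PI_mul_ge_parabola (INR h / INR n) ltac:(lra)).
    apply Rle_div_l; [nra|].
    replace (/ INR h * (INR n * sin (PI * (INR h / INR n))))
      with (sin (PI * (INR h / INR n)) / (INR h / INR n)) by (field; lra).
    apply Rle_div_r; lra.
Qed.

(** * Mean square of the sawtooth sum *)

Definition saw_sum (u : nat) : R := rsum (Nat.sqrt u) (fun n => saw n u).

(* The shifts by [j q], [j = -1, 0, 1, 2], are the multiples of [q] that can be nearest
   to [p] when [p/q] lies in [[-1, 2]], the range of [h/m - k/n] and [h/m + k/n]. *)
Definition near_int_kernel (p q : R) : R :=
  / (1 + Rabs (p + q)) + / (1 + Rabs p) + / (1 + Rabs (p - q)) + / (1 + Rabs (p - 2 * q)).

Lemma inv_1_Rabs_pos x : 0 < / (1 + Rabs x).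
Proof. apply Rinv_0_lt_compat. assert (H := Rabs_pos x). lra. Qed.

(** With [w] the distance from [p] to a suitable multiple of [q], telescoping gives [w C <= q <= Y]
    and the trivial bound [C <= Y]; together [(1 + w) C <= 2 Y]. The hypothesis [q <= Y] is met by
    [q = m n] with [m, n <= sqrt Y]. *)
Lemma cos_sum_kernel_bound p q N Y : (1 <= N)%nat ->
  0 < q <= INR Y -> - q <= p <= 2 * q ->
  Rabs (rsum Y (fun u => if (N <=? u)%nat then cos ((2 * INR u + 1) * (PI * (p / q))) else 0))
  <= 2 * INR Y * near_int_kernel p q.
Proof.
  intros HN Hq Hp.
  assert (H1 := cos_sum_bound (PI * (p / q)) N Y HN).
  assert (H2 := cos_sum_trivial_bound (PI * (p / q)) N Y).
  set (C := Rabs (rsum Y _)) in *.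
  destruct (Rabs_sin_PI_mul_shift (p / q)) as (j & Hj & Hs).
  { split; [apply Rle_div_r|apply Rle_div_l]; lra. }
  assert (HC : 0 <= C) by apply Rabs_pos.
  set (w := Rabs (p - IZR j * q)).
  assert (Hw : 0 <= w) by apply Rabs_pos.
  assert (HwC : w * C <= INR Y).
  { assert (E : Rabs (p / q - IZR j) = w / q).
    { replace (p / q - IZR j) with ((p - IZR j * q) * / q) by (field; lra).
      rewrite Rabs_mult, (Rabs_right (/ q)); [easy|].
      apply Rle_ge, Rlt_le, Rinv_0_lt_compat; lra. }
    rewrite E in Hs.
    assert (w / q * C <= 1) by (eapply Rle_trans; [apply Rmult_le_compat_r|apply H1]; easy).
    replace (w * C) with (q * (w / q * C)) by (field; lra). nra. }
  assert (Hb : C <= 2 * INR Y * / (1 + w)).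
  { apply Rle_div_r; [lra|]. nra. }
  eapply Rle_trans; [apply Hb|].
  apply Rmult_le_compat_l; [lra|].
  unfold near_int_kernel.
  assert (P1 := inv_1_Rabs_pos (p + q)). assert (P2 := inv_1_Rabs_pos p).
  assert (P3 := inv_1_Rabs_pos (p - q)). assert (P4 := inv_1_Rabs_pos (p - 2 * q)).
  unfold w. clear - Hj P1 P2 P3 P4.
  assert (Hcase : (j = -1 \/ j = 0 \/ j = 1 \/ j = 2)%Z) by lia.
  destruct Hcase as [->|[->|[->| ->]]].
  - replace (p - -1 * q) with (p + q) by ring. lra.
  - replace (p - 0 * q) with p by ring. lra.
  - replace (p - 1 * q) with (p - q) by ring. lra.
  - lra.
Qed.

(** A slope of at least [1] in absolute value spreads the values at least as far apart as
    consecutive integers. *)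
Lemma inv_affine_sum a b n : 1 <= Rabs a ->
  rsum n (fun i => / (1 + Rabs (INR i * a + b))) <= 2 * harm n.
Proof.
  intros Ha. eapply Rle_trans; [|apply (harm_abs_dist_le n (- (b / a)))].
  assert (a <> 0) by (intros ->; rewrite Rabs_R0 in Ha; lra).
  apply rsum_le; intros i _. apply Rinv_le_contravar.
  - assert (Hp := Rabs_pos (INR i - - (b / a))). lra.
  - apply Rplus_le_compat_l.
    replace (INR i * a + b) with (a * (INR i - - (b / a))) by (field; easy).
    rewrite Rabs_mult. assert (Hp := Rabs_pos (INR i - - (b / a))). nra.
Qed.

(** The four terms have slopes [h + m], [h], [h - m], [h - 2m] in [i], and [1 <= h], [h + 1 <= m]
    keep all of them at least [1] in absolute value. Hence resonance costs only a logarithm once one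
    modulus varies. *)
Lemma near_int_kernel_sum h m b n : 1 <= h -> h + 1 <= m ->
  rsum n (fun i => near_int_kernel (h * INR i + b) (m * INR i)) <= 8 * harm n.
Proof.
  intros Hh Hm. unfold near_int_kernel. rewrite !rsum_plus.
  assert (A1 := inv_affine_sum (h + m) b n ltac:(rewrite Rabs_right; lra)).
  assert (A2 := inv_affine_sum h b n ltac:(rewrite Rabs_right; lra)).
  assert (A3 := inv_affine_sum (h - m) b n ltac:(rewrite Rabs_left; lra)).
  assert (A4 := inv_affine_sum (h - 2 * m) b n ltac:(rewrite Rabs_left; lra)).
  rewrite (rsum_ext n _ (fun i => / (1 + Rabs (INR i * (h + m) + b))))
    by (intros; do 3 f_equal; ring).
  rewrite (rsum_ext n (fun i => / (1 + Rabs (h * INR i + b)))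
    (fun i => / (1 + Rabs (INR i * h + b))))
    by (intros; do 3 f_equal; ring).
  rewrite (rsum_ext n (fun i => / (1 + Rabs (h * INR i + b - m * INR i)))
    (fun i => / (1 + Rabs (INR i * (h - m) + b))))
    by (intros; do 3 f_equal; ring).
  rewrite (rsum_ext n (fun i => / (1 + Rabs (h * INR i + b - 2 * (m * INR i))))
    (fun i => / (1 + Rabs (INR i * (h - 2 * m) + b))))
    by (intros; do 3 f_equal; ring).
  lra.
Qed.

(** The conditions [m <= sqrt u] and [h < m] are encoded by zeros, so that [u], [m] and [h] run over
    a fixed box and the sums can be interchanged. *)
Definition saw_wave (u m h : nat) : R :=
  if (m * m <=? u)%nat then
    if (h <? m)%nat then saw_coef m h * sin (PI * (INR h * (2 * INR u + 1) / INR m)) else 0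
  else 0.

Lemma saw_sum_waves Y u : (u <= Y)%nat ->
  saw_sum u = - rsum (Nat.sqrt Y) (fun m => rsum (Nat.sqrt Y) (fun h => saw_wave u m h)).
Proof.
  intros Hu. unfold saw_sum. set (r := Nat.sqrt Y).
  assert (Hr : (Nat.sqrt u <= r)%nat) by now apply Nat.sqrt_le_mono.
  rewrite <- (Rmult_1_l (rsum r _)), <- Ropp_mult_distr_l_reverse, <- rsum_scal.
  rewrite <- (rsum_extend (Nat.sqrt u) r) by
    (easy || (intros i Hi; rewrite rsum_0; [ring|]; intros h _; unfold saw_wave;
      destruct (Nat.leb_spec (i * i) u) as [H|H]; [|easy];
      apply Nat.sqrt_le_square in H; lia)).
  apply rsum_ext; intros m Hm.
  assert (Hmu : (m * m <= u)%nat) by (apply Nat.sqrt_le_square; lia).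
  rewrite saw_fourier_coef by lia. rewrite Ropp_mult_distr_l_reverse, Rmult_1_l. f_equal.
  rewrite <- (rsum_extend (m - 1) r) by
    (lia || (intros i Hi; unfold saw_wave; destruct (m * m <=? u)%nat; [|easy];
      destruct (Nat.ltb_spec i m); [lia|easy])).
  apply rsum_ext; intros h Hh. unfold saw_wave.
  destruct (Nat.leb_spec (m * m) u); [|lia]. destruct (Nat.ltb_spec h m); [easy|lia].
Qed.

(** A product of two sines is half a difference of cosines; their phases [h/m - k/n] and [h/m + k/n]
    become [p1/q] and [p2/q] over the denominator [q = m n]. *)
Lemma saw_wave_correlation Y m n h k :
  let r := Nat.sqrt Y in
  (1 <= m <= r)%nat -> (1 <= n <= r)%nat -> (1 <= h)%nat -> (1 <= k)%nat -> (h < m)%nat ->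
  Rabs (rsum Y (fun u => saw_wave u m h * saw_wave u n k))
  <= INR Y * (/ INR h * / INR k)
     * (near_int_kernel (INR h * INR n + - (INR k * INR m)) (INR m * INR n)
        + near_int_kernel (INR h * INR n + INR k * INR m) (INR m * INR n)).
Proof.
  intros r Hm Hn Hh Hk Hhm.
  assert (Hm1 : 1 <= INR m) by (apply INR_ge1; lia).
  assert (Hn1 : 1 <= INR n) by (apply INR_ge1; lia).
  assert (Hh1 : 1 <= INR h) by (apply INR_ge1; lia).
  assert (Hk1 : 1 <= INR k) by (apply INR_ge1; lia).
  assert (HY : 0 <= INR Y) by apply pos_INR.
  set (p1 := INR h * INR n + - (INR k * INR m)). set (p2 := INR h * INR n + INR k * INR m).
  set (q := INR m * INR n).
  assert (K1 : 0 <= near_int_kernel p1 q).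
  { unfold near_int_kernel. pose proof (fun x => Rlt_le _ _ (inv_1_Rabs_pos x)) as P.
    repeat apply Rplus_le_le_0_compat; apply P. }
  assert (K2 : 0 <= near_int_kernel p2 q).
  { unfold near_int_kernel. pose proof (fun x => Rlt_le _ _ (inv_1_Rabs_pos x)) as P.
    repeat apply Rplus_le_le_0_compat; apply P. }
  assert (Ih : 0 < / INR h) by (apply Rinv_0_lt_compat; lra).
  assert (Ik : 0 < / INR k) by (apply Rinv_0_lt_compat; lra).
  destruct (Nat.ltb_spec k n) as [Hkn|Hkn].
  2:{ rewrite rsum_0.
      - rewrite Rabs_R0. repeat apply Rmult_le_pos; lra.
      - intros u _. unfold saw_wave at 2. destruct (n * n <=? u)%nat; [|ring].
        destruct (Nat.ltb_spec k n); [lia|ring]. }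
  set (N := Nat.max (m * m) (n * n)).
  assert (HN : (1 <= N)%nat) by (unfold N; nia).
  assert (Hq : 0 < q <= INR Y).
  { unfold q. split; [nra|]. rewrite <- mult_INR. apply le_INR.
    assert (r * r <= Y)%nat by apply Nat.sqrt_spec'. nia. }
  assert (Hhm' : INR h + 1 <= INR m) by (rewrite <- S_INR; apply le_INR; lia).
  assert (Hkn' : INR k + 1 <= INR n) by (rewrite <- S_INR; apply le_INR; lia).
  assert (B1 := cos_sum_kernel_bound p1 q N Y HN Hq ltac:(unfold p1, q; nra)).
  assert (B2 := cos_sum_kernel_bound p2 q N Y HN Hq ltac:(unfold p2, q; nra)).
  set (c1 := rsum Y _) in B1. set (c2 := rsum Y _) in B2.
  assert (E : rsum Y (fun u => saw_wave u m h * saw_wave u n k)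
     = saw_coef m h * saw_coef n k / 2 * (c1 - c2)).
  { unfold c1, c2. rewrite <- rsum_minus, <- rsum_scal. apply rsum_ext; intros u _.
    unfold saw_wave.
    destruct (Nat.ltb_spec h m); [|lia]. destruct (Nat.ltb_spec k n); [|lia].
    destruct (Nat.leb_spec N u) as [HNu|HNu]; unfold N in HNu.
    - destruct (Nat.leb_spec (m * m) u); [|lia]. destruct (Nat.leb_spec (n * n) u); [|lia].
      set (a := PI * (INR h * (2 * INR u + 1) / INR m)).
      set (b := PI * (INR k * (2 * INR u + 1) / INR n)).
      replace ((2 * INR u + 1) * (PI * (p1 / q))) with (a - b)
        by (unfold a, b, p1, q; field; lra).
      replace ((2 * INR u + 1) * (PI * (p2 / q))) with (a + b)
        by (unfold a, b, p2, q; field; lra).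
      rewrite cos_minus, cos_plus. field.
    - destruct (Nat.leb_spec (m * m) u), (Nat.leb_spec (n * n) u); try lia; ring. }
  rewrite E, Rabs_mult.
  assert (Cm := saw_coef_bound m h ltac:(lia)). assert (Cn := saw_coef_bound n k ltac:(lia)).
  assert (Hc : 0 <= saw_coef m h * saw_coef n k <= / INR h * / INR k)
    by (split; [|apply Rmult_le_compat]; nra).
  rewrite (Rabs_right (_ / 2)) by lra.
  assert (Hd : Rabs (c1 - c2) <= 2 * INR Y * (near_int_kernel p1 q + near_int_kernel p2 q)).
  { unfold Rminus. eapply Rle_trans; [apply Rabs_triang|]. rewrite Rabs_Ropp. lra. }
  replace (INR Y * (/ INR h * / INR k) * (near_int_kernel p1 q + near_int_kernel p2 q))
    with (/ INR h * / INR k / 2 * (2 * INR Y * (near_int_kernel p1 q + near_int_kernel p2 q)))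
    by (field; split; lra).
  apply Rmult_le_compat; [lra|apply Rabs_pos|lra|easy].
Qed.

(** Both phases are affine in [n], so each kernel contributes [8 harm r]. The diagonal needs no
    separate treatment. *)
Lemma saw_wave_correlation_sum Y m h k :
  let r := Nat.sqrt Y in
  (1 <= m <= r)%nat -> (1 <= h)%nat -> (1 <= k)%nat ->
  rsum r (fun n => rsum Y (fun u => saw_wave u m h * saw_wave u n k))
  <= 16 * INR Y * harm r * / INR h * / INR k.
Proof.
  intros r Hm Hh Hk.
  assert (Hh1 : 1 <= INR h) by (apply INR_ge1; lia).
  assert (Hk1 : 1 <= INR k) by (apply INR_ge1; lia).
  assert (HY : 0 <= INR Y) by apply pos_INR.
  assert (Ih : 0 < / INR h) by (apply Rinv_0_lt_compat; lra).
  assert (Ik : 0 < / INR k) by (apply Rinv_0_lt_compat; lra).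
  assert (Hr := harm_ge0 r).
  destruct (Nat.ltb_spec h m) as [Hhm|Hhm].
  2:{ rewrite rsum_0.
      - repeat apply Rmult_le_pos; lra.
      - intros n _. apply rsum_0; intros u _. unfold saw_wave at 1.
        destruct (m * m <=? u)%nat; [|ring]. destruct (Nat.ltb_spec h m); [lia|ring]. }
  assert (Hhm' : INR h + 1 <= INR m) by (rewrite <- S_INR; apply le_INR; lia).
  assert (S1 := near_int_kernel_sum (INR h) (INR m) (- (INR k * INR m)) r Hh1 Hhm').
  assert (S2 := near_int_kernel_sum (INR h) (INR m) (INR k * INR m) r Hh1 Hhm').
  eapply Rle_trans.
  - apply rsum_le; intros n Hn. eapply Rle_trans; [apply Rle_abs|].
    apply (saw_wave_correlation Y m n h k); easy.
  - rewrite rsum_scal, rsum_plus.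
    replace (16 * INR Y * harm r * / INR h * / INR k)
      with (INR Y * (/ INR h * / INR k) * (16 * harm r)) by ring.
    apply Rmult_le_compat_l; [repeat apply Rmult_le_pos; lra|lra].
Qed.

(** The sums are arranged as [m, h, k, n, u], outermost first. The sum over [m] is counted trivially
    and gives [sqrt Y]; [h] and [k] give one harmonic sum each through the coefficients, and [n]
    gives the third. *)
Lemma saw_sum_mean_square Y :
  rsum Y (fun u => saw_sum u ^ 2)
  <= 16 * INR Y * INR (Nat.sqrt Y) * harm (Nat.sqrt Y) ^ 3.
Proof.
  set (r := Nat.sqrt Y).
  rewrite (rsum_ext Y _ (fun u => rsum r (fun m => rsum r (fun n =>
    rsum r (fun h => rsum r (fun k => saw_wave u m h * saw_wave u n k)))))).
  2:{ intros u Hu. rewrite (saw_sum_waves Y u) by lia. fold r.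
      replace ((- rsum r (fun m => rsum r (fun h => saw_wave u m h))) ^ 2)
        with (rsum r (fun m => rsum r (fun h => saw_wave u m h))
              * rsum r (fun m => rsum r (fun h => saw_wave u m h))) by ring.
      rewrite rsum_mult. apply rsum_ext; intros m _. apply rsum_ext; intros n _.
      apply rsum_mult. }
  rewrite rsum_swap.
  replace (16 * INR Y * INR r * harm r ^ 3) with (INR r * (16 * INR Y * harm r * harm r * harm r))
    by ring.
  rewrite <- rsum_const. apply rsum_le; intros m Hm.
  rewrite rsum_swap.
  rewrite (rsum_ext r _ (fun n => rsum r (fun h => rsum r (fun k =>
     rsum Y (fun u => saw_wave u m h * saw_wave u n k))))).
  2:{ intros n _. rewrite rsum_swap. apply rsum_ext; intros h _. apply rsum_swap. }
  rewrite rsum_swap.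
  unfold harm at 3. rewrite <- rsum_scal. apply rsum_le; intros h Hh.
  rewrite rsum_swap.
  replace (16 * INR Y * harm r * harm r * / INR h)
    with (16 * INR Y * harm r * / INR h * harm r) by ring.
  unfold harm at 2. rewrite <- rsum_scal. apply rsum_le; intros k Hk.
  apply (saw_wave_correlation_sum Y m h k); unfold r in *; lia.
Qed.

(** * Euler's constant and the harmonic numbers *)

Lemma nonneg_of_derive_nonneg (F dF : R -> R) y :
  (forall x, 0 <= x -> is_derive F x (dF x)) -> (forall x, 0 <= x -> 0 <= dF x) ->
  F 0 = 0 -> 0 <= y -> 0 <= F y.
Proof.
  intros HF HdF H0 Hy.
  destruct (MVT_gen F 0 y dF) as (c & Hc & E).
  - intros x Hx. rewrite Rmin_left in Hx by lra. apply HF; lra.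
  - intros x Hx. rewrite Rmin_left in Hx by lra.
    apply continuity_pt_filterlim, @ex_derive_continuous. exists (dF x). apply HF; lra.
  - rewrite Rmin_left in Hc by lra.
    assert (0 <= dF c) by (apply HdF; lra). nra.
Qed.

(** Error of the trapezoid rule for the integral of [1/t] over [[1, 1 + y]]. Its derivative
    [y^2 / (2 (1 + y)^2)] lies between [0] and [y^2/2]. *)
Lemma ln_1p_trapezoid y : 0 <= y ->
  0 <= y / 2 + y / (2 * (1 + y)) - ln (1 + y) <= y ^ 3 / 6.
Proof.
  intros Hy. split.
  - apply (nonneg_of_derive_nonneg (fun y => y / 2 + y / (2 * (1 + y)) - ln (1 + y))
      (fun y => y ^ 2 / (2 * (1 + y) ^ 2))); [| | |easy].
    + intros x Hx. auto_derive; [split; [lra|split; [lra|easy]]|field; lra].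
    + intros x Hx. apply Rmult_le_pos; [nra|]. left; apply Rinv_0_lt_compat. nra.
    + rewrite Rplus_0_r, ln_1. field.
  - assert (H : 0 <= y ^ 3 / 6 - (y / 2 + y / (2 * (1 + y)) - ln (1 + y))); [|lra].
    apply (nonneg_of_derive_nonneg
      (fun y => y ^ 3 / 6 - (y / 2 + y / (2 * (1 + y)) - ln (1 + y)))
      (fun y => y ^ 2 / 2 - y ^ 2 / (2 * (1 + y) ^ 2))); [| | |easy].
    + intros x Hx. auto_derive; [split; [lra|split; [lra|easy]]|field; lra].
    + intros x Hx.
      replace (x ^ 2 / 2 - x ^ 2 / (2 * (1 + x) ^ 2))
        with (x ^ 2 / 2 * (((1 + x) ^ 2 - 1) / (1 + x) ^ 2)) by (field; lra).
      apply Rmult_le_pos; [nra|]. apply Rmult_le_pos; [nra|].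
      left; apply Rinv_0_lt_compat. nra.
    + rewrite Rplus_0_r, ln_1. field.
Qed.

(** The correction [1/(2n)] leaves an error [O(1/n^2)] from [euler_gamma]. The hyperbola method
    multiplies it by [u], about [r^2], so an error [O(1/r)] would be too large. *)
Definition harm_trapezoid (n : nat) : R := harm n - ln (INR n) - / (2 * INR n).

(** The step is the trapezoid error at [y = 1/n], at most [1/(6 n^3)]. Its majorant is chosen to
    telescope, so that adding [1/n^2] turns the increasing sequence into a decreasing one. *)
Lemma harm_trapezoid_step n : (1 <= n)%nat ->
  0 <= harm_trapezoid (S n) - harm_trapezoid n <= / INR n ^ 2 - / INR (S n) ^ 2.
Proof.
  intros Hn. assert (Hn1 := INR_ge1 n Hn). unfold harm_trapezoid.
  unfold harm; change (rsum (S n) ?F) with (rsum n F + F (S n)); cbv beta.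
  fold (harm n). rewrite S_INR. set (t := INR n) in *.
  destruct (ln_1p_trapezoid (/ t)) as [H1 H2].
  { left; apply Rinv_0_lt_compat; lra. }
  assert (E : ln (1 + / t) = ln (t + 1) - ln t).
  { rewrite <- ln_div by lra. f_equal. field; lra. }
  rewrite E in H1, H2.
  replace (/ t / 2 + / t / (2 * (1 + / t))) with (/ (2 * t) + / (t + 1) - / (2 * (t + 1)))
    in H1, H2 by (field; lra).
  assert (H3 : (/ t) ^ 3 / 6 <= / t ^ 2 - / (t + 1) ^ 2).
  { assert (E3 : / t ^ 2 - / (t + 1) ^ 2 - (/ t) ^ 3 / 6
      = (11 * t ^ 2 + 4 * t - 1) / (6 * t ^ 3 * (t + 1) ^ 2)) by (field; lra).
    assert (0 <= (11 * t ^ 2 + 4 * t - 1) / (6 * t ^ 3 * (t + 1) ^ 2)); [|lra].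
    apply Rmult_le_pos; [nra|]. left; apply Rinv_0_lt_compat.
    apply Rmult_lt_0_compat; [|nra]. assert (0 < t ^ 3) by (apply pow_lt; lra). lra. }
  lra.
Qed.

Lemma is_lim_seq_inv_INR_S : is_lim_seq (fun n => / INR (S n)) 0.
Proof.
  apply (is_lim_seq_incr_1 (fun n => / INR n)).
  replace (Finite 0) with (Rbar_inv p_infty) by easy.
  apply is_lim_seq_inv; [apply is_lim_seq_INR|easy].
Qed.

(** [Lim_seq] is total, so [euler_gamma] has its meaning only once convergence is known:
    [harm n - ln n] decreases and is bounded below. *)
Lemma harm_trapezoid_lim : is_lim_seq (fun n => harm_trapezoid (S n)) euler_gamma.
Proof.
  pose (g := fun N => sum_f_R0 (fun k => / INR (S k)) N - ln (INR (S N))).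
  assert (Eg : forall N, g N = harm (S N) - ln (INR (S N))).
  { intros N. unfold g. f_equal. induction N as [|N IH].
    - unfold harm; simpl; ring.
    - rewrite tech5, IH. easy. }
  assert (Hstep : forall n, g (S n) <= g n).
  { intros n. rewrite !Eg. unfold harm; change (rsum (S (S n)) ?F) with (rsum (S n) F + F (S (S n)));
    cbv beta. fold (harm (S n)).
    assert (Hn : 1 <= INR (S n)) by (apply INR_ge1; lia).
    assert (H := one_sub_inv_le_ln (INR (S (S n)) / INR (S n))).
    rewrite (S_INR (S n)) in *. rewrite ln_div in H by lra.
    replace (1 - / ((INR (S n) + 1) / INR (S n))) with (/ (INR (S n) + 1)) in H by (field; lra).
    specialize (H ltac:(apply Rdiv_lt_0_compat; lra)). lra. }
  assert (Hlow : forall n, 0 <= g n).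
  { assert (Hm : forall n, harm_trapezoid 1 <= harm_trapezoid (S n)).
    { induction n as [|n IH]; [lra|].
      assert (H := harm_trapezoid_step (S n) ltac:(lia)). lra. }
    intros n. specialize (Hm n). unfold harm_trapezoid in Hm at 1.
    unfold harm in Hm; simpl in Hm. rewrite ln_1 in Hm. rewrite Eg.
    unfold harm_trapezoid in Hm.
    assert (0 < / (2 * INR (S n))).
    { apply Rinv_0_lt_compat. assert (1 <= INR (S n)) by (apply INR_ge1; lia). lra. }
    change (match n with O => 1 | S _ => INR n + 1 end) with (INR (S n)) in Hm.
    change (harm (S n)) with (rsum n (fun i => / INR i) + / INR (S n)).
    change (harm (S n)) with (rsum n (fun i => / INR i) + / INR (S n)) in Hm. lra. }
  assert (Hg : is_lim_seq g euler_gamma).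
  { apply Lim_seq_correct', (ex_finite_lim_seq_decr g 0 Hstep Hlow). }
  apply (is_lim_seq_ext (fun n => g n - / 2 * / INR (S n))).
  - intros n. rewrite Eg. unfold harm_trapezoid. rewrite Rinv_mult. easy.
  - replace (Finite euler_gamma) with (Finite (euler_gamma - / 2 * 0)) by (f_equal; ring).
    apply is_lim_seq_minus'; [easy|].
    apply (is_lim_seq_scal_l _ (/ 2) (Finite 0)), is_lim_seq_inv_INR_S.
Qed.

(** [euler_gamma] is the common limit of the increasing [harm_trapezoid n] and the decreasing
    [harm_trapezoid n + 1/n^2]. *)
Lemma harm_asymp n : (1 <= n)%nat ->
  - / INR n ^ 2 <= harm n - ln (INR n) - euler_gamma - / (2 * INR n) <= 0.
Proof.
  intros Hn. destruct n as [|n]; [lia|].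
  assert (H1 : harm_trapezoid (S n) <= euler_gamma).
  { apply (is_lim_seq_incr_compare (fun n => harm_trapezoid (S n))).
    - apply harm_trapezoid_lim.
    - intros k. assert (H := harm_trapezoid_step (S k) ltac:(lia)). lra. }
  assert (H2 : euler_gamma <= harm_trapezoid (S n) + / INR (S n) ^ 2).
  { apply (is_lim_seq_decr_compare (fun n => harm_trapezoid (S n) + / INR (S n) ^ 2)).
    - replace (Finite euler_gamma) with (Finite (euler_gamma + 0 * 0)) by (f_equal; ring).
      apply is_lim_seq_plus'; [apply harm_trapezoid_lim|].
      apply (is_lim_seq_ext (fun n => / INR (S n) * / INR (S n))).
      + intros k. rewrite <- Rinv_mult. f_equal; ring.
      + apply is_lim_seq_mult'; apply is_lim_seq_inv_INR_S.
    - intros k. assert (H := harm_trapezoid_step (S k) ltac:(lia)). lra. }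
  unfold harm_trapezoid in *. lra.
Qed.

(** * The divisor problem: hyperbola method and mean square *)

Definition Dsum (u : nat) : R := rsum u (fun n => INR (u / n)).

Definition divisor_main (t : R) : R := t * ln t + (2 * euler_gamma - 1) * t.

Definition Delta (u : nat) : R := Dsum u - divisor_main (INR u).

Lemma rsum_indicator_le N m : (m <= N)%nat ->
  rsum N (fun k => if (k <=? m)%nat then 1 else 0) = INR m.
Proof.
  intros H. rewrite <- (rsum_extend m N).
  - rewrite (rsum_ext _ _ (fun _ => 1)); [rewrite rsum_const; ring|].
    intros i Hi. destruct (Nat.leb_spec i m); [easy|lia].
  - easy.
  - intros i Hi. destruct (Nat.leb_spec i m); [lia|easy].
Qed.

(** Inclusion and exclusion for lattice points under [n k <= u]: each has a coordinate at most [r],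
    and the square [n, k <= r] lies entirely under the hyperbola, so its count [r^2] needs no
    indicator [I]. *)
Lemma Dsum_hyperbola u :
  let r := Nat.sqrt u in
  Dsum u = 2 * rsum r (fun n => INR (u / n)) - INR r ^ 2.
Proof.
  intros r.
  assert (Hr : (r * r <= u < S r * S r)%nat) by apply Nat.sqrt_spec'.
  assert (Hru : (r <= u)%nat) by nia.
  pose (I := fun n k : nat => if (n * k <=? u)%nat then 1 else 0).
  pose (J := fun n : nat => if (n <=? r)%nat then 1 else 0).
  assert (HI : forall n, (1 <= n)%nat -> rsum u (I n) = INR (u / n)).
  { intros n Hn. rewrite <- (rsum_indicator_le u (u / n)).
    - apply rsum_ext; intros k _. unfold I.
      destruct (Nat.leb_spec (n * k) u), (Nat.leb_spec k (u / n)); try easy; exfalso.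
      + assert (k <= u / n)%nat by (apply Nat.div_le_lower_bound; lia). lia.
      + assert (n * (u / n) <= u)%nat by (apply Nat.Div0.mul_div_le). nia.
    - apply Nat.Div0.div_le_upper_bound; nia. }
  assert (HJ : forall F, rsum u (fun n => J n * F n) = rsum r F).
  { intros F. rewrite <- (rsum_extend r u); [|easy|].
    - apply rsum_ext; intros i Hi. unfold J. destruct (Nat.leb_spec i r); [ring|lia].
    - intros i Hi. unfold J. destruct (Nat.leb_spec i r); [lia|ring]. }
  assert (E1 : rsum u (fun n => rsum u (fun k => J n * I n k)) = rsum r (fun n => INR (u / n))).
  { rewrite (rsum_ext _ _ (fun n => J n * rsum u (I n))) by (intros; apply rsum_scal).
    rewrite HJ. apply rsum_ext; intros; apply HI; lia. }
  assert (E2 : rsum u (fun n => rsum u (fun k => J k * I n k)) = rsum r (fun n => INR (u / n))).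
  { rewrite rsum_swap, <- E1. do 2 (apply rsum_ext; intros ? _). unfold I.
    now rewrite (Nat.mul_comm i0 i). }
  assert (E3 : rsum u (fun n => rsum u (fun k => J n * J k)) = INR r ^ 2).
  { rewrite <- rsum_mult. unfold J. rewrite rsum_indicator_le by easy. ring. }
  unfold Dsum. rewrite (rsum_ext _ _ (fun n => rsum u (fun k => J n * I n k)
    + rsum u (fun k => J k * I n k) - rsum u (fun k => J n * J k))).
  - rewrite rsum_minus, rsum_plus, E1, E2, E3. ring.
  - intros n Hn. rewrite <- HI by lia. rewrite <- rsum_plus, <- rsum_minus.
    apply rsum_ext; intros k Hk. unfold I, J.
    destruct (Nat.leb_spec (n * k) u), (Nat.leb_spec n r), (Nat.leb_spec k r);
      solve [ring|nia].
Qed.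

Lemma INR_div_saw u n : (1 <= n)%nat ->
  INR (u / n) = INR u * / INR n - saw n u - / 2 + / 2 * / INR n.
Proof.
  intros Hn. assert (Hn1 := INR_ge1 n Hn).
  assert (E := f_equal INR (Nat.Div0.div_mod u n)). rewrite plus_INR, mult_INR in E.
  unfold saw. rewrite E. field. lra.
Qed.

(** Put [t = u - r^2], so [0 <= t <= 2r]. The main terms cancel exactly, leaving [2 u e] with [e]
    the harmonic error, between [-6] and [0], then [harm r], then [t - u ln (1 + t/r^2)], between
    [-4] and [0], and [t/r <= 2]. *)
Lemma Delta_saw_sum u : (1 <= u)%nat ->
  Rabs (Delta u + 2 * saw_sum u) <= 12 + harm (Nat.sqrt u).
Proof.
  intros Hu. unfold Delta. rewrite Dsum_hyperbola. set (r := Nat.sqrt u).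
  assert (Hr : (r * r <= u < S r * S r)%nat) by apply Nat.sqrt_spec'.
  assert (Hr1 : (1 <= r)%nat) by nia.
  assert (HA := harm_asymp r Hr1). assert (Hh := harm_ge0 r).
  assert (Hrr := INR_ge1 r Hr1).
  assert (E : rsum r (fun n => INR (u / n))
    = INR u * harm r - saw_sum u - INR r * / 2 + / 2 * harm r).
  { unfold saw_sum, harm. fold r. rewrite <- !rsum_scal, <- rsum_const.
    rewrite <- !rsum_minus, <- rsum_plus. apply rsum_ext; intros n Hn. apply INR_div_saw; lia. }
  rewrite E. unfold divisor_main.
  set (e := harm r - ln (INR r) - euler_gamma - / (2 * INR r)) in HA.
  assert (Hu1 : INR r ^ 2 <= INR u).
  { replace (INR r ^ 2) with (INR (r * r)) by (rewrite mult_INR; ring). apply le_INR; lia. }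
  assert (Hu2 : INR u <= INR r ^ 2 + 2 * INR r).
  { replace (INR r ^ 2 + 2 * INR r) with (INR (r * r + 2 * r))
      by (rewrite plus_INR, !mult_INR; simpl; ring). apply le_INR; lia. }
  set (R1 := INR r) in *. set (U := INR u) in *.
  set (t := U - R1 ^ 2). assert (Ht : 0 <= t <= 2 * R1) by (unfold t; lra).
  assert (HR2 : 0 < R1 ^ 2) by nra.
  set (y := t / R1 ^ 2).
  assert (Hy : 0 <= y) by (apply Rmult_le_pos; [lra|left; apply Rinv_0_lt_compat; lra]).
  assert (EU : U = R1 ^ 2 * (1 + y)) by (unfold y, t; field; lra).
  assert (Hty : R1 ^ 2 * y = t) by (unfold y; field; lra).
  assert (Hln : ln U = 2 * ln R1 + ln (1 + y)).
  { rewrite EU, ln_mult by lra. simpl. rewrite Rmult_1_r, ln_mult by lra. ring. }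
  assert (L1 : U * ln (1 + y) <= t + 4).
  { assert (H := ln_le_sub_one (1 + y) ltac:(lra)).
    assert (t * y <= 4).
    { replace (t * y) with (t * t / R1 ^ 2) by (unfold y; field; lra).
      apply Rle_div_l; [lra|nra]. }
    assert (U * ln (1 + y) <= U * y) by (apply Rmult_le_compat_l; lra).
    rewrite EU in *. nra. }
  assert (L2 : t <= U * ln (1 + y)).
  { assert (H := one_sub_inv_le_ln (1 + y) ltac:(lra)).
    assert (U * (1 - / (1 + y)) <= U * ln (1 + y)) by (apply Rmult_le_compat_l; lra).
    replace (U * (1 - / (1 + y))) with t in H0; [lra|].
    rewrite EU, <- Hty. field; lra. }
  assert (Hq : 0 <= t / R1 <= 2).
  { split; [apply Rmult_le_pos; [lra|left; apply Rinv_0_lt_compat; lra]|apply Rle_div_l; lra]. }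
  assert (HUr : U / R1 = R1 + t / R1) by (unfold t; field; lra).
  assert (He : -6 <= 2 * U * e <= 0).
  { assert (U * / R1 ^ 2 <= 3).
    { change (U / R1 ^ 2 <= 3). apply Rle_div_l; [lra|nra]. }
    split; nra. }
  assert (Hmain : 2 * (U * harm r - saw_sum u - R1 * / 2 + / 2 * harm r) - R1 ^ 2 -
     (U * ln U + (2 * euler_gamma - 1) * U) + 2 * saw_sum u
     = 2 * U * e + harm r + (t + t / R1 - U * ln (1 + y))).
  { rewrite Hln. unfold e, t. field. lra. }
  rewrite Hmain. apply Rabs_le; lra.
Qed.

Lemma Delta_mean_square Y : (1 <= Y)%nat ->
  rsum Y (fun u => Delta u ^ 2) <= 500 * INR Y * INR (Nat.sqrt Y) * harm (Nat.sqrt Y) ^ 3.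
Proof.
  intros HY. set (r := Nat.sqrt Y).
  assert (Hr : (r * r <= Y < S r * S r)%nat) by apply Nat.sqrt_spec'.
  assert (Hr1 : (1 <= r)%nat) by nia. assert (HR := INR_ge1 r Hr1).
  assert (Hh : 1 <= harm r).
  { replace 1 with (harm 1) by (unfold harm; simpl; field). now apply harm_mono. }
  assert (HY0 := INR_ge1 Y HY).
  eapply Rle_trans.
  (* From [(e - 2 s)^2 <= 2 e^2 + 8 s^2]. With [(12 + harm r)^2 <= 169 harm r ^ 2] the constants add
     up to [8 * 16 + 2 * 169 = 466]. *)
  - apply (rsum_le Y _ (fun u => 8 * saw_sum u ^ 2 + 2 * (12 + harm r) ^ 2)).
    intros u Hu. assert (H := Delta_saw_sum u ltac:(lia)).
    assert (Hm : harm (Nat.sqrt u) <= harm r) by (apply harm_mono, Nat.sqrt_le_mono; lia).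
    apply Rabs_le_between in H. set (e := Delta u + 2 * saw_sum u) in H.
    replace (Delta u) with (e - 2 * saw_sum u) by (unfold e; ring).
    assert (e ^ 2 <= (12 + harm r) ^ 2) by (apply pow_maj_Rabs, Rabs_le; lra).
    assert (0 <= (e + 2 * saw_sum u) ^ 2) by apply pow2_ge_0. nra.
  - rewrite rsum_plus, rsum_scal, rsum_const.
    assert (H := saw_sum_mean_square Y). fold r in H.
    assert (H2 : (12 + harm r) ^ 2 <= 169 * (INR r * harm r ^ 3)).
    { assert ((12 + harm r) ^ 2 <= (13 * harm r) ^ 2) by (apply pow_incr; lra).
      assert (harm r ^ 2 <= harm r ^ 3) by (apply Rle_pow; [lra|lia]).
      assert (0 <= harm r ^ 3) by (apply pow_le; lra). nra. }
    assert (H3 : INR Y * (2 * (12 + harm r) ^ 2) <= INR Y * (2 * (169 * (INR r * harm r ^ 3))))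
      by (apply Rmult_le_compat_l; lra).
    assert (0 <= INR Y * INR r * harm r ^ 3).
    { apply Rmult_le_pos; [nra|apply pow_le; lra]. }
    lra.
Qed.

(** * From the mean square to the sum of [|Delta (X/d)|] *)

Lemma rsum_shift a n F : rsum (a + n) F = rsum a F + rsum n (fun i => F (a + i)%nat).
Proof.
  induction n as [|n IH]; [rewrite Nat.add_0_r; simpl; ring|].
  rewrite Nat.add_succ_r; simpl. rewrite IH, Nat.add_succ_r. ring.
Qed.

Lemma euler_gamma_bounds : 1 / 2 <= euler_gamma <= 3 / 2.
Proof.
  assert (H := harm_asymp 1 ltac:(lia)). unfold harm in H; simpl in H. rewrite ln_1 in H. lra.
Qed.

(** The derivative is [ln t + 2 euler_gamma], and the crude bounds [1/2] and [3/2] for [euler_gamma]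
    give the sign and the constant [3]. *)
Lemma divisor_main_slope a b : 1 <= a <= b ->
  0 <= divisor_main b - divisor_main a <= (b - a) * (ln b + 3).
Proof.
  intros H. assert (Hg := euler_gamma_bounds). unfold divisor_main.
  assert (L : 0 <= ln b - ln a) by (assert (ln a <= ln b) by (apply ln_le; lra); lra).
  assert (L2 := ln_le_sub_one (b / a) ltac:(apply Rdiv_lt_0_compat; lra)).
  rewrite ln_div in L2 by lra.
  assert (E : a * (ln b - ln a) <= b - a).
  { replace (b - a) with (a * (b / a - 1)) by (field; lra). apply Rmult_le_compat_l; lra. }
  assert (Hb := ln_ge0 b ltac:(lra)).
  assert (0 <= (b - a) * ln b) by (apply Rmult_le_pos; lra).
  assert (0 <= a * (ln b - ln a)) by (apply Rmult_le_pos; lra).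
  nra.
Qed.

Lemma Dsum_mono u v : (u <= v)%nat -> Dsum u <= Dsum v.
Proof.
  intros H. unfold Dsum. apply Rle_trans with (rsum u (fun n => INR (v / n))).
  - apply rsum_le; intros n Hn. now apply le_INR, Nat.Div0.div_le_mono.
  - apply rsum_mono; [easy|]; intros; apply pos_INR.
Qed.

Lemma Delta_drop u v : (1 <= u <= v)%nat ->
  Delta u - Delta v <= (INR v - INR u) * (ln (INR v) + 3).
Proof.
  intros H. assert (H1 : 1 <= INR u) by (apply INR_ge1; lia).
  assert (H2 : INR u <= INR v) by (apply le_INR; lia).
  assert (S := divisor_main_slope (INR u) (INR v) ltac:(lra)).
  assert (M := Dsum_mono u v ltac:(lia)). unfold Delta. lra.
Qed.

(** Average of [g i <= H + g i ^ 2 / H], which trades first powers for the squares controlled by the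
    mean square. *)
Lemma le_window_average H x c (g : nat -> R) : (1 <= H)%nat ->
  (forall i, (1 <= i <= H)%nat -> x <= c + g i) ->
  x <= c + INR H + / INR H ^ 2 * rsum H (fun i => g i ^ 2).
Proof.
  intros HH Hx. assert (H1 := INR_ge1 H HH).
  assert (S : INR H * x <= INR H * (c + INR H) + / INR H * rsum H (fun i => g i ^ 2)).
  { rewrite <- rsum_scal, <- !rsum_const, <- rsum_plus. apply rsum_le; intros i Hi.
    specialize (Hx i Hi).
    assert (g i <= INR H + / INR H * g i ^ 2); [|lra].
    apply (Rmult_le_reg_l (INR H)); [lra|].
    replace (INR H * (INR H + / INR H * g i ^ 2)) with (INR H ^ 2 + g i ^ 2) by (field; lra).
    assert (0 <= (2 * g i - INR H) ^ 2) by apply pow2_ge_0. nra. }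
  apply (Rmult_le_reg_l (INR H)); [lra|].
  replace (INR H * (c + INR H + / INR H ^ 2 * rsum H (fun i => g i ^ 2)))
    with (INR H * (c + INR H) + / INR H * rsum H (fun i => g i ^ 2)) by (field; lra). easy.
Qed.

(* [Delta] cannot drop faster than [ln] per step, so a large value of either sign
   persists over a one-sided window of length [H]. *)
Lemma Delta_window_bound u H : (1 <= H < u)%nat ->
  Rabs (Delta u) <= INR H * (ln (INR (u + H)) + 4)
    + / INR H ^ 2 * (rsum (u + H) (fun v => Delta v ^ 2) - rsum (u - H) (fun v => Delta v ^ 2)).
Proof.
  intros HH. assert (H1 : 1 <= INR H) by (apply INR_ge1; lia).
  assert (Hu : 1 <= INR u) by (apply INR_ge1; lia).
  set (G := fun n => rsum n (fun v => Delta v ^ 2)).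
  assert (GM : forall a b, (a <= b)%nat -> G a <= G b).
  { intros a b Hab. apply rsum_mono; [easy|]. intros; apply pow2_ge_0. }
  change (Rabs (Delta u) <= INR H * (ln (INR (u + H)) + 4) + / INR H ^ 2 * (G (u + H)%nat - G (u - H)%nat)).
  assert (HI : 0 < / INR H ^ 2) by (apply Rinv_0_lt_compat; nra).
  set (L := ln (INR (u + H))).
  assert (HuH : INR (u + H) = INR u + INR H) by apply plus_INR.
  assert (HL : 0 <= L) by (apply ln_ge0; lra).
  apply Rabs_le; split; cycle 1.
  (* A large positive value persists to the right of [u]. *)
  - assert (A := le_window_average H (Delta u) (INR H * (L + 3))
      (fun i => Delta (u + i)) ltac:(lia)).
    assert (E : rsum H (fun i => Delta (u + i) ^ 2) = G (u + H)%nat - G u).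
    { unfold G. rewrite rsum_shift. ring. }
    cbv beta in A. rewrite E in A. assert (GM1 := GM (u - H)%nat u ltac:(lia)).
    assert (Delta u <= INR H * (L + 3) + INR H + / INR H ^ 2 * (G (u + H)%nat - G u)).
    { eapply Rle_trans; [apply A|lra]. intros i Hi.
      assert (D := Delta_drop u (u + i) ltac:(lia)).
      assert (INR i <= INR H) by (apply le_INR; lia).
      assert (0 <= INR i) by apply pos_INR.
      assert (ln (INR (u + i)) <= L) by (apply ln_le; rewrite ?plus_INR; lra).
      rewrite plus_INR in D at 1.
      assert ((INR u + INR i - INR u) * (ln (INR (u + i)) + 3) <= INR H * (L + 3)); [|lra].
      assert (0 <= ln (INR (u + i))) by (apply ln_ge0; rewrite plus_INR; lra).
      apply Rmult_le_compat; lra. }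
    assert (/ INR H ^ 2 * (G (u + H)%nat - G u) <= / INR H ^ 2 * (G (u + H)%nat - G (u - H)%nat))
      by (apply Rmult_le_compat_l; lra). lra.
  (* A large negative value must have been present already to the left of [u]. *)
  - assert (A := le_window_average H (- Delta u) (INR H * (L + 3))
      (fun i => - Delta (u - H + i)) ltac:(lia)).
    assert (E : rsum H (fun i => (- Delta (u - H + i)) ^ 2) = G u - G (u - H)%nat).
    { replace (G u) with (G (u - H + H)%nat) by (f_equal; lia). unfold G. rewrite rsum_shift.
      rewrite (rsum_ext H _ (fun i => Delta (u - H + i) ^ 2)) by (intros; ring). ring. }
    cbv beta in A. rewrite E in A. assert (GM1 := GM u (u + H)%nat ltac:(lia)).
    assert (- Delta u <= INR H * (L + 3) + INR H + / INR H ^ 2 * (G u - G (u - H)%nat)).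
    { eapply Rle_trans; [apply A|lra]. intros i Hi.
      assert (D := Delta_drop (u - H + i) u ltac:(lia)).
      assert (INR (u - H + i) = INR u - INR H + INR i)
        by (rewrite plus_INR, minus_INR by lia; ring).
      assert (INR i <= INR H) by (apply le_INR; lia).
      assert (0 <= INR i) by apply pos_INR.
      assert (ln (INR u) <= L) by (apply ln_le; lra).
      assert (0 <= ln (INR u)) by (apply ln_ge0; lra).
      assert ((INR u - INR (u - H + i)) * (ln (INR u) + 3) <= INR H * (L + 3)); [|lra].
      apply Rmult_le_compat; lra. }
    assert (/ INR H ^ 2 * (G u - G (u - H)%nat) <= / INR H ^ 2 * (G (u + H)%nat - G (u - H)%nat))
      by (apply Rmult_le_compat_l; lra). lra.
Qed.

(** As [G] is monotone, the gaps between windows may be filled in and the sum telescopes. The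
    centres [v i] move down, so the first window is the highest. *)
Lemma disjoint_windows (G : nat -> R) (v : nat -> nat) H n :
  (forall a b, (a <= b)%nat -> G a <= G b) -> 0 <= G 0%nat ->
  (forall i, (1 <= i < n)%nat -> (v (S i) + H <= v i - H)%nat) ->
  (1 <= n)%nat ->
  rsum n (fun i => G (v i + H)%nat - G (v i - H)%nat) <= G (v 1%nat + H)%nat.
Proof.
  intros GM G0 Hv Hn.
  assert (A : forall m, (1 <= m <= n)%nat ->
    rsum m (fun i => G (v i + H)%nat - G (v i - H)%nat)
    <= G (v 1%nat + H)%nat - G (v m - H)%nat).
  { induction m as [|m IH]; [lia|]. intros Hm. simpl rsum.
    destruct (Nat.eq_dec m 0) as [->|Hm0]; [simpl; lra|].
    specialize (IH ltac:(lia)). assert (B := GM _ _ (Hv m ltac:(lia))). lra. }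
  specialize (A n ltac:(lia)). assert (B := GM 0%nat (v n - H)%nat ltac:(lia)). lra.
Qed.

Lemma INR_div_bounds X d : (1 <= d)%nat ->
  INR X / INR d - 1 < INR (X / d) <= INR X / INR d.
Proof.
  intros Hd. assert (H1 := INR_ge1 d Hd).
  assert (E := Nat.Div0.div_mod X d). assert (M := Nat.mod_upper_bound X d ltac:(lia)).
  split.
  - apply (Rmult_lt_reg_l (INR d)); [lra|].
    replace (INR d * (INR X / INR d - 1)) with (INR X - INR d) by (field; lra).
    rewrite <- mult_INR. assert (INR X < INR (d * (X / d)) + INR d); [|lra].
    rewrite <- plus_INR. apply lt_INR. lia.
  - apply Rle_div_r; [lra|]. rewrite <- mult_INR. apply le_INR. lia.
Qed.

Lemma nat_floor_exists t : 1 <= t -> exists n, (1 <= n)%nat /\ INR n <= t /\ t / 2 <= INR n.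
Proof.
  intros Ht. destruct (archimed t) as [A1 A2].
  assert (Hz : (1 <= up t - 1)%Z) by (assert (1 < up t)%Z by (apply lt_IZR; lra); lia).
  exists (Z.to_nat (up t - 1)). split; [lia|].
  rewrite INR_IZR_INZ, Z2Nat.id by lia.
  apply IZR_le in Hz. rewrite minus_IZR in *. lra.
Qed.

Lemma INR_sqrt_le n : INR (Nat.sqrt n) ^ 2 <= INR n.
Proof.
  replace (INR (Nat.sqrt n) ^ 2) with (INR (Nat.sqrt n * Nat.sqrt n)) by (rewrite mult_INR; ring).
  apply le_INR. apply Nat.sqrt_spec'.
Qed.

(** [H] is chosen with [q^4/2 <= H D <= q^4]. The window widths then total about [q^4], and the mean
    square at height [Y ~ 2X/D] contributes at most about [q^4] as long as [D] is below [q^3]. *)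
Lemma Delta_block_sum (X D : nat) (q : R) : (1 <= D)%nat -> 1 <= q -> q ^ 7 = INR X ->
  24 * INR D <= q ^ 3 ->
  rsum D (fun i => Rabs (Delta (X / (D + i)))) <= 4003 * q ^ 4 * (2 + ln (INR X)) ^ 3.
Proof.
  intros HD Hq HX HDq. assert (HD1 := INR_ge1 D HD).
  assert (Hq4 : 1 <= q ^ 4) by (apply pow_R1_Rle; easy).
  assert (Hq3 : 1 <= q ^ 3) by (apply pow_R1_Rle; easy).
  assert (Hqq4 : q ^ 3 <= q ^ 4) by (apply Rle_pow; [easy|lia]).
  assert (H43 : q ^ 7 = q ^ 4 * q ^ 3) by ring.
  destruct (nat_floor_exists (q ^ 4 / INR D)) as (H & HH & Hup & Hlo).
  { apply Rle_div_r; lra. }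
  assert (HH1 := INR_ge1 H HH).
  assert (HHD : INR H * INR D <= q ^ 4) by (apply Rle_div_r in Hup; lra).
  assert (HDH : q ^ 4 <= 2 * (INR H * INR D)).
  { replace (q ^ 4) with (q ^ 4 / INR D / 2 * (2 * INR D)) by (field; lra). nra. }
  assert (HX0 : 1 <= INR X) by (rewrite <- HX; apply pow_R1_Rle; easy).
  assert (Hsp : forall d, (D <= d <= 2 * D)%nat -> (X / S d + H <= X / d - H)%nat).
  { intros d Hd. assert (Hd1 : 1 <= INR d) by (apply INR_ge1; lia).
    assert (Hd2 : INR d <= 2 * INR D)
      by (replace (2 * INR D) with (INR (2 * D)) by (rewrite mult_INR; simpl; ring); apply le_INR; lia).
    assert (B1 := INR_div_bounds X d ltac:(lia)).
    assert (B2 := INR_div_bounds X (S d) ltac:(lia)).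
    (* The gap is [X / (d (d + 1))], while [(2H + 1) d (d + 1) <= 18 (H D) D <= 18 q^4 D]; the
       condition [24 D <= q^3] makes this at most [q^7]. The extra [1] pays for rounding down. *)
    assert (Gap : 2 * INR H + 1 <= INR X / INR d - INR X / INR (S d)).
    { rewrite S_INR. replace (INR X / INR d - INR X / (INR d + 1))
        with (INR X / (INR d * (INR d + 1))) by (field; lra).
      apply Rle_div_r; [nra|]. rewrite <- HX, H43.
      assert (INR d * (INR d + 1) <= 6 * (INR D * INR D)) by nra.
      assert ((2 * INR H + 1) * (INR d * (INR d + 1)) <= 3 * INR H * (6 * (INR D * INR D)))
        by (apply Rmult_le_compat; nra).
      assert (3 * INR H * (6 * (INR D * INR D)) = 18 * (INR H * INR D) * INR D) by ring.
      assert (18 * (INR H * INR D) * INR D <= 18 * q ^ 4 * INR D) by nra.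
      nra. }
    assert (Hlt : INR (X / S d) + 2 * INR H < INR (X / d)) by lra.
    replace (INR (X / S d) + 2 * INR H) with (INR (X / S d + 2 * H)) in Hlt
      by (rewrite plus_INR, mult_INR; simpl; ring).
    apply INR_lt in Hlt. lia. }
  set (L := 2 + ln (INR X)). assert (HlnX := ln_ge0 _ HX0).
  assert (HL : 2 <= L) by (unfold L; lra).
  assert (HLp : L <= L ^ 3) by (assert (1 <= L ^ 2) by nra; nra).
  set (G := fun n => rsum n (fun v => Delta v ^ 2)).
  assert (GM : forall a b, (a <= b)%nat -> G a <= G b).
  { intros a b Hab. apply rsum_mono; [easy|]. intros; apply pow2_ge_0. }
  assert (HXD : forall d, (D <= d)%nat -> (X / d <= X / D)%nat).
  { intros d Hd. apply Nat.div_le_compat_l; lia. }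
  assert (HHX : (H <= X / D)%nat) by (specialize (Hsp D ltac:(lia)); lia).
  assert (HXDX : (X / D <= X)%nat) by (apply Nat.Div0.div_le_upper_bound; nia).
  eapply Rle_trans.
  { apply (rsum_le D _ (fun i => INR H * (3 * L)
      + / INR H ^ 2 * (G (X / (D + i) + H)%nat - G (X / (D + i) - H)%nat))).
    intros i Hi. assert (S := Hsp (D + i)%nat ltac:(lia)).
    eapply Rle_trans; [apply (Delta_window_bound _ H); lia|].
    apply Rplus_le_compat_r, Rmult_le_compat_l; [lra|].
    assert (ln (INR (X / (D + i) + H)) <= ln (2 * INR X)).
    { apply ln_le; [apply lt_0_INR; lia|].
      replace (2 * INR X) with (INR (2 * X)) by (rewrite mult_INR; simpl; ring).
      apply le_INR. specialize (HXD (D + i)%nat ltac:(lia)). lia. }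
    rewrite ln_mult in H0 by lra. assert (ln 2 <= 1) by (assert (Q := ln_le_sub_one 2); lra).
    unfold L. lra. }
  rewrite rsum_plus, rsum_const, rsum_scal.
  assert (W := disjoint_windows G (fun i => X / (D + i))%nat H D GM ltac:(unfold G; simpl; lra)).
  specialize (W ltac:(intros i Hi; cbv beta; rewrite Nat.add_succ_r; apply Hsp; lia) HD).
  cbv beta in W.
  (* Above the top of the highest window, because [H <= X / D]. *)
  set (Y := (2 * (X / D))%nat).
  assert (HY1 : (1 <= Y)%nat) by lia.
  assert (GY : G (X / (D + 1) + H)%nat <= G Y) by (apply GM; specialize (HXD (D + 1)%nat); lia).
  assert (MS := Delta_mean_square Y HY1). fold (G Y) in MS.
  assert (HYr : INR D * INR Y <= 2 * q ^ 7).
  { unfold Y. rewrite mult_INR. assert (B := INR_div_bounds X D HD).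
    assert (INR D * INR (X / D) <= INR X).
    { rewrite <- mult_INR. apply le_INR, Nat.Div0.mul_div_le. }
    rewrite HX. simpl. lra. }
  set (s := INR (Nat.sqrt Y)) in *.
  assert (Hs : s ^ 2 <= INR Y) by apply INR_sqrt_le.
  assert (Hs0 : 0 <= s) by apply pos_INR.
  assert (HY0 : 0 <= INR Y) by apply pos_INR.
  assert (HDs : INR D * s <= q ^ 5).
  { apply Rsqr_incr_0; [|nra|apply pow_le; lra]. unfold Rsqr.
    replace (q ^ 5 * q ^ 5) with (q ^ 7 * q ^ 3) by ring.
    assert (q ^ 7 * (2 * INR D) <= q ^ 7 * q ^ 3)
      by (apply Rmult_le_compat_l; [apply pow_le|]; lra).
    nra. }
  assert (Hharm : harm (Nat.sqrt Y) <= L).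
  { eapply Rle_trans; [apply (harm_mono _ Y)|].
    - apply Nat.sqrt_le_lin.
    - eapply Rle_trans; [apply harm_le_ln; easy|].
      assert (ln (INR Y) <= ln (2 * INR X)).
      { apply ln_le; [apply lt_0_INR; lia|].
        replace (2 * INR X) with (INR (2 * X)) by (rewrite mult_INR; simpl; ring).
        apply le_INR. lia. }
      rewrite ln_mult in H0 by lra. assert (ln 2 <= 1) by (assert (Q := ln_le_sub_one 2); lra).
      unfold L. lra. }
  assert (Hh3 : harm (Nat.sqrt Y) ^ 3 <= L ^ 3) by (apply pow_incr; split; [apply harm_ge0|easy]).
  (* One factor [D] is paired with [Y], the other with [sqrt Y]: [D Y <= 2 q^7] and [D s <= q^5]. *)
  assert (GB : INR D ^ 2 * G Y <= 1000 * q ^ 12 * L ^ 3).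
  { assert (T1 : INR D * INR Y * (INR D * s) <= 2 * q ^ 7 * q ^ 5)
      by (apply Rmult_le_compat; nra).
    replace (1000 * q ^ 12 * L ^ 3) with (500 * (2 * q ^ 7 * q ^ 5) * L ^ 3) by ring.
    apply Rle_trans with (500 * (INR D * INR Y * (INR D * s)) * harm (Nat.sqrt Y) ^ 3).
    - replace (500 * (INR D * INR Y * (INR D * s)) * harm (Nat.sqrt Y) ^ 3)
        with (INR D ^ 2 * (500 * INR Y * s * harm (Nat.sqrt Y) ^ 3)) by ring.
      apply Rmult_le_compat_l; [nra|easy].
    - apply Rmult_le_compat; [|apply pow_le, harm_ge0|lra|easy].
      apply Rmult_le_pos; [lra|]. apply Rmult_le_pos; nra. }
  assert (HI : 0 < / INR H ^ 2) by (apply Rinv_0_lt_compat; nra).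
  (* [H D >= q^4/2] gives [1/H^2 <= 4 D^2 / q^8], whence [4 * 1000]. *)
  assert (GH : / INR H ^ 2 * G Y <= 4000 * q ^ 4 * L ^ 3).
  { rewrite Rmult_comm. change (G Y / INR H ^ 2 <= 4000 * q ^ 4 * L ^ 3).
    apply Rle_div_l; [nra|].
    assert (Z : q ^ 8 <= 4 * (INR H ^ 2 * INR D ^ 2)).
    { replace (q ^ 8) with (q ^ 4 * q ^ 4) by ring. nra. }
    assert (HL3 : 0 <= L ^ 3) by lra.
    apply (Rmult_le_reg_l (INR D ^ 2)); [nra|].
    eapply Rle_trans; [apply GB|].
    replace (INR D ^ 2 * (4000 * q ^ 4 * L ^ 3 * INR H ^ 2))
      with (1000 * q ^ 4 * L ^ 3 * (4 * (INR H ^ 2 * INR D ^ 2))) by ring.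
    replace (1000 * q ^ 12 * L ^ 3) with (1000 * q ^ 4 * L ^ 3 * q ^ 8) by ring.
    apply Rmult_le_compat_l; [|easy]. repeat apply Rmult_le_pos; lra. }
  assert (/ INR H ^ 2 * rsum D (fun i => G (X / (D + i) + H)%nat - G (X / (D + i) - H)%nat)
     <= / INR H ^ 2 * G Y) by (apply Rmult_le_compat_l; lra).
  assert (INR D * (INR H * (3 * L)) <= 3 * q ^ 4 * L ^ 3).
  { replace (INR D * (INR H * (3 * L))) with (3 * (INR H * INR D) * L) by ring.
    apply Rmult_le_compat; nra. }
  lra.
Qed.

Lemma saw_abs_le n u : (1 <= n)%nat -> Rabs (saw n u) <= 1.
Proof.
  intros Hn. assert (H1 := INR_ge1 n Hn). unfold saw.
  assert (M : (u mod n < n)%nat) by (apply Nat.mod_upper_bound; lia). apply lt_INR in M.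
  assert (P := pos_INR (u mod n)).
  assert (0 <= INR (u mod n) / INR n <= 1).
  { split; [apply Rmult_le_pos; [easy|left; apply Rinv_0_lt_compat; lra]|apply Rle_div_l; lra]. }
  assert (0 <= (INR n - 1) / (2 * INR n) <= 1).
  { split; [apply Rmult_le_pos; [lra|left; apply Rinv_0_lt_compat; lra]|apply Rle_div_l; lra]. }
  apply Rabs_le; lra.
Qed.

Lemma Delta_trivial_bound u : (1 <= u)%nat ->
  Rabs (Delta u) <= 2 * INR (Nat.sqrt u) + 12 + harm u.
Proof.
  intros Hu. assert (A := Delta_saw_sum u Hu).
  assert (B : Rabs (saw_sum u) <= INR (Nat.sqrt u)).
  { unfold saw_sum. eapply Rle_trans; [apply rsum_abs|].
    rewrite <- (Rmult_1_r (INR (Nat.sqrt u))), <- rsum_const. apply rsum_le; intros i Hi.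
    apply saw_abs_le; lia. }
  assert (C := harm_mono (Nat.sqrt u) u (Nat.sqrt_le_lin u)).
  apply Rabs_le_between in A. apply Rabs_le_between in B. apply Rabs_le; lra.
Qed.

(** Dyadic blocks [(D, 2D]] with [D = 2^j <= M] cover [2..M], and their number costs the fourth
    logarithm. The term [d = 1] belongs to no block, but [Delta X] is trivially about
    [sqrt X <= q^4]. *)
Lemma Delta_hyperbolic_sum (X M : nat) (q : R) : 1 <= q -> q ^ 7 = INR X ->
  24 * INR M <= q ^ 3 ->
  rsum M (fun d => Rabs (Delta (X / d))) <= 9000 * q ^ 4 * (2 + ln (INR X)) ^ 4.
Proof.
  intros Hq HX HMq.
  assert (Hq4 : 1 <= q ^ 4) by (apply pow_R1_Rle; easy).
  assert (HX0 : 1 <= INR X) by (rewrite <- HX; apply pow_R1_Rle; easy).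
  assert (HX1 : (1 <= X)%nat) by (destruct X; [simpl in HX0; lra|lia]).
  assert (HlnX := ln_ge0 _ HX0).
  set (L := 2 + ln (INR X)). assert (HL : 2 <= L) by (unfold L; lra).
  set (F := fun d => Rabs (Delta (X / d))).
  set (B := 4003 * q ^ 4 * L ^ 3).
  assert (HL3 : 8 <= L ^ 3) by (assert (4 <= L ^ 2) by nra; simpl in *; nra).
  destruct (Nat.eq_dec M 0) as [->|HM0].
  { simpl rsum. repeat apply Rmult_le_pos; lra || apply pow_le; lra. }
  assert (Hblocks : forall k, (2 ^ k <= 2 * M)%nat -> rsum (2 ^ k) F <= F 1%nat + INR k * B).
  { induction k as [|k IH]; intros Hk; [simpl; lra|].
    rewrite Nat.pow_succ_r' in *. replace (2 * 2 ^ k)%nat with (2 ^ k + 2 ^ k)%nat by lia.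
    rewrite rsum_shift, S_INR. specialize (IH ltac:(lia)).
    assert (HD : (1 <= 2 ^ k)%nat) by (assert (2 ^ k <> 0)%nat by (apply Nat.pow_nonzero; lia); lia).
    assert (INR (2 ^ k) <= INR M) by (apply le_INR; lia).
    assert (C := Delta_block_sum X (2 ^ k) q HD Hq HX ltac:(lra)). fold L in C. fold B in C.
    change (rsum (2 ^ k) (fun i => F (2 ^ k + i)%nat) <= B) in C. lra. }
  set (k := Nat.log2_up M).
  assert (Hk : (M <= 2 ^ k <= 2 * M)%nat).
  { destruct (Nat.eq_dec M 1) as [E|E].
    - unfold k. rewrite E. simpl. lia.
    - assert (S := Nat.log2_up_spec M ltac:(lia)). fold k in S.
      assert (k <> 0)%nat by (intros E0; rewrite E0 in S; simpl in S; lia).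
      replace (2 ^ k)%nat with (2 * 2 ^ pred k)%nat
        by (rewrite <- Nat.pow_succ_r'; f_equal; lia).
      replace (2 ^ k)%nat with (2 * 2 ^ pred k)%nat in S
        by (rewrite <- Nat.pow_succ_r'; f_equal; lia). lia. }
  assert (Hmono : rsum M F <= rsum (2 ^ k) F).
  { apply rsum_mono; [lia|]. intros; apply Rabs_pos. }
  specialize (Hblocks k ltac:(lia)).
  assert (HkL : INR k <= 2 * L).
  { assert (P : INR (2 ^ k) <= 2 * INR X).
    { assert (INR M <= INR X).
      { rewrite <- HX. assert (q ^ 3 <= q ^ 7) by (apply Rle_pow; [easy|lia]).
        assert (0 <= INR M) by apply pos_INR. lra. }
      assert (INR (2 ^ k) <= INR (2 * M)) by (apply le_INR; lia).
      rewrite mult_INR in H0. simpl in H0. lra. }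
    rewrite pow_INR in P. replace (INR 2) with 2 in P by (simpl; ring).
    apply ln_le in P; [|apply pow_lt; lra]. rewrite ln_pow, ln_mult in P by lra.
    assert (1 / 2 <= ln 2) by (assert (Q := one_sub_inv_le_ln 2); lra).
    assert (ln 2 <= 1) by (assert (Q := ln_le_sub_one 2); lra).
    assert (0 <= INR k) by apply pos_INR. unfold L. nra. }
  assert (HF1 : F 1%nat <= 2 * q ^ 4 + 12 + L).
  { unfold F. rewrite Nat.div_1_r. eapply Rle_trans; [apply Delta_trivial_bound; easy|].
    assert (A := harm_le_ln X HX1).
    assert (INR (Nat.sqrt X) <= q ^ 4); [|unfold L; lra].
    apply Rsqr_incr_0; [|apply pos_INR|lra]. unfold Rsqr.
    assert (S := INR_sqrt_le X). rewrite <- HX in S.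
    assert (q ^ 7 <= q ^ 8) by (apply Rle_pow; [easy|lia]).
    replace (q ^ 4 * q ^ 4) with (q ^ 8) by ring. lra. }
  assert (HB : INR k * B <= 2 * L * B).
  { apply Rmult_le_compat_r; [|easy]. unfold B. repeat apply Rmult_le_pos; lra. }
  assert (E : 2 * L * B = 8006 * (q ^ 4 * L ^ 4)) by (unfold B; ring).
  assert (HL4 : 16 <= L ^ 4) by (replace (L ^ 4) with (L * L ^ 3) by ring; nra).
  assert (L <= L ^ 4) by (replace (L ^ 4) with (L * L ^ 3) by ring; nra).
  assert (q ^ 4 * 1 <= q ^ 4 * L ^ 4) by (apply Rmult_le_compat_l; lra).
  assert (1 * L ^ 4 <= q ^ 4 * L ^ 4) by (apply Rmult_le_compat_r; lra).
  unfold F in *. lra.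
Qed.

(** * Sorting the pairs by the value of the quotient *)

(* The divisor function: [Dsum] is its summatory function. *)
Definition tau (n : nat) : R := Dsum n - Dsum (n - 1).

Lemma tau_ge0 n : 0 <= tau n.
Proof. unfold tau. assert (H := Dsum_mono (n - 1) n ltac:(lia)). lra. Qed.

Lemma succ_div_cases u a : (1 <= a)%nat ->
  (S u / a = u / a)%nat \/ (S u / a = S (u / a) /\ a * S (u / a) = S u)%nat.
Proof.
  intros Ha. assert (E := Nat.Div0.div_mod u a). assert (M := Nat.mod_upper_bound u a ltac:(lia)).
  destruct (Nat.eq_dec (S (u mod a)) a) as [H|H].
  - right. assert (E' : (a * S (u / a) = S u)%nat) by lia. split; [|easy].
    rewrite <- E', Nat.mul_comm. apply Nat.div_mul. lia.
  - left. symmetry. apply (Nat.div_unique _ _ _ (S (u mod a))); lia.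
Qed.

(** Induction on [u]: the inner range for [a] grows only if [a] divides [S u], the new product is
    then [S u], and these jumps of [u / a] add up to [tau (S u)]. *)
Lemma sum_pairs_tau u (g : nat -> R) :
  rsum u (fun a => rsum (u / a) (fun b => g (a * b)%nat)) = rsum u (fun n => g n * tau n).
Proof.
  induction u as [|u IH]; [easy|].
  change (rsum (S u) (fun n => g n * tau n)) with (rsum u (fun n => g n * tau n) + g (S u) * tau (S u)).
  rewrite <- IH.
  rewrite (rsum_extend u (S u) (fun a => rsum (u / a) _));
    [|lia|intros i Hi; rewrite Nat.div_small by lia; easy].
  assert (E : tau (S u) = rsum (S u) (fun a => INR (S u / a) - INR (u / a))).
  { unfold tau. rewrite Nat.sub_succ, Nat.sub_0_r, rsum_minus. f_equal.
    unfold Dsum. apply rsum_extend; [lia|]. intros i Hi. now rewrite Nat.div_small by lia. }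
  rewrite E, <- rsum_scal, <- rsum_plus. apply rsum_ext; intros a Ha.
  destruct (succ_div_cases u a ltac:(lia)) as [->|[-> H]]; [ring|].
  simpl rsum. rewrite H, S_INR. ring.
Qed.

Lemma tau_sum_telescope a k : rsum k (fun i => tau (a + i)) = Dsum (a + k) - Dsum a.
Proof.
  induction k as [|k IH]; [rewrite Nat.add_0_r; simpl; ring|].
  simpl rsum. rewrite IH. unfold tau.
  replace (a + S k - 1)%nat with (a + k)%nat by lia. ring.
Qed.

Lemma div_eq_on_window X d n : (X / S d < n <= X / d)%nat -> (1 <= d)%nat -> (X / n = d)%nat.
Proof.
  intros Hn Hd. assert (A := Nat.Div0.mul_div_le X d).
  assert (B := Nat.mul_succ_div_gt X (S d) ltac:(lia)).
  assert (n * d <= X)%nat by (apply Nat.le_trans with (d * (X / d))%nat;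
    [rewrite Nat.mul_comm; apply Nat.mul_le_mono_l; lia|easy]).
  assert (X < n * S d)%nat by (apply Nat.lt_le_trans with (S d * S (X / S d))%nat;
    [easy|rewrite Nat.mul_comm; apply Nat.mul_le_mono_r; lia]).
  symmetry. apply (Nat.div_unique X n d (X - n * d)); lia.
Qed.

(** Induction on [M] peels off the possibly empty window [X / S (S M) < n <= X / S M], on which the
    quotient is [S M]. *)
Lemma sum_by_quotient X M (f : nat -> R) :
  rsum X (fun n => f (X / n)%nat * tau n)
  = rsum (X / S M) (fun n => f (X / n)%nat * tau n)
    + rsum M (fun d => f d * (Dsum (X / d) - Dsum (X / S d))).
Proof.
  induction M as [|M IH]; [rewrite Nat.div_1_r; simpl; ring|].
  rewrite IH. simpl (rsum (S M) _). rewrite Rplus_comm, (Rplus_comm (rsum (X / S (S M)) _)).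
  rewrite Rplus_assoc. f_equal.
  assert (H : (X / S (S M) <= X / S M)%nat) by (apply Nat.div_le_compat_l; lia).
  replace (X / S M)%nat with (X / S (S M) + (X / S M - X / S (S M)))%nat at 1 by lia.
  rewrite rsum_shift, Rplus_comm. f_equal.
  rewrite (rsum_ext _ _ (fun i => f (S M) * tau (X / S (S M) + i))).
  - rewrite rsum_scal, tau_sum_telescope.
    now replace (X / S (S M) + (X / S M - X / S (S M)))%nat with (X / S M)%nat by lia.
  - intros i Hi. rewrite (div_eq_on_window X (S M)); [easy|lia|lia].
Qed.

(** The pairs under the hyperbola are enlarged to the full square. *)
Lemma tau_over_n_sum N : rsum N (fun n => / INR n * tau n) <= harm N ^ 2.
Proof.
  rewrite <- sum_pairs_tau. replace (harm N ^ 2) with (harm N * harm N) by ring.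
  unfold harm at 1 2. rewrite rsum_mult. apply rsum_le; intros a Ha.
  eapply Rle_trans with (rsum (N / a) (fun b => / INR a * / INR b)).
  - apply Req_le, rsum_ext; intros b _. now rewrite mult_INR, Rinv_mult.
  - apply rsum_mono; [apply Nat.Div0.div_le_upper_bound; nia|].
    intros b Hb. apply Rmult_le_pos; left; apply Rinv_0_lt_compat, lt_0_INR; lia.
Qed.

Lemma Rpower_ge0 x y : 0 <= Rpower x y.
Proof. left; apply exp_pos. Qed.

Lemma Rpower_ge1 x y : 1 <= x -> 0 <= y -> 1 <= Rpower x y.
Proof. intros Hx Hy. rewrite <- (Rpower_O x) by lra. apply Rle_Rpower; lra. Qed.

(** [(X/n)^alpha = X^alpha n^(1 - alpha) / n], and [n^(1 - alpha)] is replaced by its value at [N],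
    leaving the sum of [tau n / n]. *)
Lemma sum_small_n_bound X N (f : nat -> R) A alpha :
  0 <= A -> 0 <= alpha < 1 ->
  (forall n, (1 <= n)%nat -> Rabs (f n) <= A * Rpower (INR n) alpha) ->
  (1 <= N <= X)%nat ->
  Rabs (rsum N (fun n => f (X / n)%nat * tau n))
  <= A * Rpower (INR X) alpha * Rpower (INR N) (1 - alpha) * harm N ^ 2.
Proof.
  intros HA Ha Hf HN.
  eapply Rle_trans; [apply rsum_abs|].
  eapply Rle_trans with (rsum N (fun n =>
    (A * Rpower (INR X) alpha * Rpower (INR N) (1 - alpha)) * (/ INR n * tau n))).
  - apply rsum_le; intros n Hn.
    assert (Hn1 : 1 <= INR n) by (apply INR_ge1; lia).
    assert (HX1 : 1 <= INR X) by (apply INR_ge1; lia).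
    rewrite Rabs_mult, (Rabs_right (tau n)) by (apply Rle_ge, tau_ge0).
    rewrite <- Rmult_assoc. apply Rmult_le_compat_r; [apply tau_ge0|].
    assert (Hq : (1 <= X / n)%nat) by (apply Nat.div_le_lower_bound; lia).
    eapply Rle_trans; [apply Hf; easy|]. rewrite !Rmult_assoc. apply Rmult_le_compat_l; [easy|].
    apply Rle_trans with (Rpower (INR X / INR n) alpha).
    { apply Rle_Rpower_l; [lra|]. split; [apply lt_0_INR; lia|]. apply INR_div_bounds; lia. }
    unfold Rdiv.
    rewrite <- Rpower_mult_distr; [|lra|apply Rinv_0_lt_compat; lra].
    apply Rmult_le_compat_l; [apply Rpower_ge0|].
    apply Rle_trans with (Rpower (INR n) (1 - alpha) * / INR n).
    { apply Req_le. unfold Rminus. rewrite Rpower_plus, Rpower_1 by lra.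
      rewrite Rpower_Ropp. unfold Rpower at 1. rewrite ln_Rinv by lra.
      replace (alpha * - ln (INR n)) with (- (alpha * ln (INR n))) by ring.
      rewrite exp_Ropp. unfold Rpower. field. split; [lra|apply Rgt_not_eq, exp_pos]. }
    apply Rmult_le_compat_r; [left; apply Rinv_0_lt_compat; lra|].
    apply Rle_Rpower_l; [lra|]. split; [lra|]. apply le_INR; lia.
  - rewrite rsum_scal. apply Rmult_le_compat_l; [|apply tau_over_n_sum].
    repeat apply Rmult_le_pos; try apply Rpower_ge0; easy.
Qed.

(** * Tails of the two series *)

(** Discrete derivative of [t^(-b)], with the left side shaped like the terms of the series. The
    factor [1/2] comes from [exp (- z) <= 1 - z/2] on [[0, 1]]. *)
Lemma Rpower_neg_step n b : (1 <= n)%nat -> 0 < b <= 1 ->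
  b / 2 * (Rpower (INR n) (1 - b) / (INR n * INR (S n)))
  <= Rpower (INR n) (- b) - Rpower (INR (S n)) (- b).
Proof.
  intros Hn Hb. assert (Hn1 := INR_ge1 n Hn). rewrite S_INR. set (t := INR n) in *.
  assert (E1 : Rpower t (1 - b) = t * Rpower t (- b))
    by (unfold Rminus; rewrite Rpower_plus, Rpower_1 by lra; easy).
  rewrite E1.
  assert (Ht : 0 < / t <= 1).
  { split; [apply Rinv_0_lt_compat; lra|]. rewrite <- Rinv_1. apply Rinv_le_contravar; lra. }
  set (z := b * ln (1 + / t)).
  assert (E2 : Rpower (t + 1) (- b) = Rpower t (- b) * exp (- z)).
  { unfold Rpower, z. rewrite <- exp_plus. f_equal.
    replace (t + 1) with (t * (1 + / t)) by (field; lra). rewrite ln_mult by lra. ring. }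
  rewrite E2.
  assert (L1 := one_sub_inv_le_ln (1 + / t) ltac:(lra)).
  assert (L2 := ln_le_sub_one (1 + / t) ltac:(lra)).
  replace (1 - / (1 + / t)) with (/ (t + 1)) in L1 by (field; lra).
  assert (Ht1 : 0 < / (t + 1)) by (apply Rinv_0_lt_compat; lra).
  assert (Hz : 0 <= z <= 1) by (unfold z; split; [apply Rmult_le_pos; lra|nra]).
  assert (Hez : exp (- z) <= 1 - z / 2).
  { rewrite exp_Ropp. assert (X := exp_ineq1_le z).
    apply Rle_trans with (/ (1 + z)); [apply Rinv_le_contravar; lra|].
    apply (Rmult_le_reg_l (1 + z)); [lra|]. rewrite Rinv_r by lra. nra. }
  assert (P := Rpower_ge0 t (- b)).
  replace (b / 2 * (t * Rpower t (- b) / (t * (t + 1)))) with (Rpower t (- b) * (b * / (t + 1) / 2))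
    by (field; lra).
  assert (b * / (t + 1) <= z) by (unfold z; apply Rmult_le_compat_l; lra).
  replace (Rpower t (- b) - Rpower t (- b) * exp (- z)) with (Rpower t (- b) * (1 - exp (- z))) by ring.
  apply Rmult_le_compat_l; lra.
Qed.

Lemma sum_n_rsum (g : nat -> R) n : sum_n (fun k => g (S k)) n = rsum (S n) g.
Proof.
  induction n as [|n IH]; [rewrite sum_O; simpl; ring|].
  rewrite sum_Sn, IH. easy.
Qed.

(** The terms are dominated by differences of [(2 B / b) n^(-b)], so one telescoping majorant gives
    both convergence and the tail. *)
Lemma series_tail_bound (g : nat -> R) B b : 0 <= B -> 0 < b <= 1 ->
  (forall n, (1 <= n)%nat -> Rabs (g n) <= B * (Rpower (INR n) (1 - b) / (INR n * INR (S n)))) ->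
  ex_series (fun k => g (S k)) /\
  forall M, Rabs (Series (fun k => g (S k)) - rsum M g) <= 2 * B / b * Rpower (INR (S M)) (- b).
Proof.
  intros HB Hb Hg.
  set (p := fun n => Rpower (INR n) (- b)).
  assert (Hp : forall n, 0 <= p n) by (intros; apply Rpower_ge0).
  set (K := 2 * B / b). assert (HK : 0 <= K).
  { apply Rmult_le_pos; [lra|left; apply Rinv_0_lt_compat; lra]. }
  assert (Hstep : forall n, (1 <= n)%nat -> Rabs (g n) <= K * (p n - p (S n))).
  { intros n Hn. eapply Rle_trans; [apply Hg; easy|].
    assert (Hs := Rpower_neg_step n b Hn Hb). fold (p n) (p (S n)) in Hs.
    set (w := Rpower (INR n) (1 - b) / (INR n * INR (S n))) in *. replace (B * w) with (K * (b / 2 * w)) by (unfold K; field; lra).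
    apply Rmult_le_compat_l; easy. }
  assert (Hex : ex_series (fun k => g (S k))).
  { apply (@ex_series_le R_AbsRing R_CompleteNormedModule _ (fun k => K * (p (S k) - p (S (S k))))).
    - intros k. apply Hstep; lia.
    - assert (Hsum : forall n, sum_n (fun k => K * (p (S k) - p (S (S k)))) n
        = K * (p 1%nat - p (S (S n)))).
      { induction n as [|n IH]; [now rewrite sum_O|]. rewrite sum_Sn, IH.
        unfold plus; simpl; ring. }
      destruct (ex_finite_lim_seq_incr (sum_n (fun k => K * (p (S k) - p (S (S k))))) (K * p 1%nat))
        as [l Hl].
      + intros n. rewrite sum_Sn. unfold plus; simpl.
        assert (0 <= K * (p (S (S n)) - p (S (S (S n))))); [|lra].
        eapply Rle_trans; [apply Rabs_pos|apply (Hstep (S (S n))); lia].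
      + intros n. rewrite Hsum. specialize (Hp (S (S n))). nra.
      + exists l. exact Hl. }
  split; [easy|]. intros M.
  assert (Hdiff : forall k, Rabs (rsum (M + k) g - rsum M g) <= K * p (S M)).
  { intros k. apply Rle_trans with (K * (p (S M) - p (S (M + k)))).
    - rewrite rsum_shift.
      replace (rsum M g + rsum k (fun i => g (M + i)%nat) - rsum M g)
        with (rsum k (fun i => g (M + i)%nat)) by ring.
      induction k as [|k IH].
      + simpl. rewrite Rabs_R0, Nat.add_0_r. lra.
      + simpl rsum. eapply Rle_trans; [apply Rabs_triang|].
        assert (Hs := Hstep (M + S k)%nat ltac:(lia)). rewrite Nat.add_succ_r in *. lra.
    - specialize (Hp (S (M + k))). nra. }
  destruct Hex as [l Hl]. rewrite (is_series_unique _ _ Hl).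
  assert (Hlim : is_lim_seq (fun k => rsum (M + S k) g) l).
  { apply (is_lim_seq_ext (fun k => sum_n (fun k => g (S k)) (k + M))).
    - intros k. rewrite sum_n_rsum. f_equal. lia.
    - apply (is_lim_seq_incr_n (sum_n (fun k => g (S k))) M). exact Hl. }
  assert (Hbounds : forall k, rsum M g - K * p (S M) <= rsum (M + S k) g <= rsum M g + K * p (S M)).
  { intros k. specialize (Hdiff (S k)). apply Rabs_le_between in Hdiff. lra. }
  assert (U := is_lim_seq_le _ _ _ (Finite (rsum M g + K * p (S M))) (fun k => proj2 (Hbounds k))
    Hlim (is_lim_seq_const _)).
  assert (V := is_lim_seq_le _ _ (Finite (rsum M g - K * p (S M))) _ (fun k => proj1 (Hbounds k))
    (is_lim_seq_const _) Hlim).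
  simpl in U, V. change (Rabs (l - rsum M g) <= K * p (S M)). apply Rabs_le; lra.
Qed.

(** Over the denominator [t (t + 1)] the numerator is [ln t - t (ln (t + 1) - ln t)], whose
    subtracted part lies in [[0, 1]]. *)
Lemma ln_over_n_step n : (1 <= n)%nat ->
  Rabs (ln (INR n) / INR n - ln (INR (S n)) / INR (S n)) <= (1 + ln (INR n)) / (INR n * INR (S n)).
Proof.
  intros Hn. assert (H1 := INR_ge1 n Hn). rewrite S_INR. set (t := INR n) in *.
  assert (Hl := ln_ge0 t H1).
  assert (A : ln t <= ln (t + 1)) by (apply ln_le; lra).
  assert (B := ln_le_sub_one ((t + 1) / t) ltac:(apply Rdiv_lt_0_compat; lra)).
  rewrite ln_div in B by lra.
  assert (C : t * (ln (t + 1) - ln t) <= 1).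
  { apply Rle_trans with (t * ((t + 1) / t - 1)); [apply Rmult_le_compat_l; lra|].
    apply Req_le; field; lra. }
  assert (D : 0 <= t * (ln (t + 1) - ln t)) by (apply Rmult_le_pos; lra).
  replace (ln t / t - ln (t + 1) / (t + 1))
    with ((ln t - t * (ln (t + 1) - ln t)) * / (t * (t + 1))) by (field; lra).
  assert (0 < / (t * (t + 1))) by (apply Rinv_0_lt_compat; nra).
  rewrite Rabs_mult, (Rabs_right (/ _)) by lra.
  apply Rmult_le_compat_r; [lra|]. apply Rabs_le; lra.
Qed.

Lemma ln_le_Rpower t d : 0 < d -> 1 <= t -> ln t <= / d * Rpower t d.
Proof.
  intros Hd Ht. assert (H := exp_ineq1_le (d * ln t)). fold (Rpower t d) in H.
  apply (Rmult_le_reg_l d); [easy|]. rewrite <- Rmult_assoc, Rinv_r by lra. lra.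
Qed.

(** * The asymptotic formula for real-valued functions *)

(** Each term contains the error [E] at [d] and at [S d], hence twice its sum up to [S M], while
    [|g d| <= A q^(3 alpha)] because [d <= q^3]. [E] differs from [Delta] by rounding [X/d] down
    inside the main term. The index [S M] may violate the size condition and is bounded
    trivially. *)
Lemma quotient_sum_approx (X M : nat) (q A alpha : R) (g : nat -> R) :
  1 <= q -> q ^ 7 = INR X -> 24 * INR M <= q ^ 3 -> 0 <= A -> 0 <= alpha < 1 ->
  (forall n, (1 <= n)%nat -> Rabs (g n) <= A * Rpower (INR n) alpha) ->
  Rabs (rsum M (fun d => g d * (Dsum (X / d) - Dsum (X / S d)))
        - rsum M (fun d => g d * (divisor_main (INR X / INR d) - divisor_main (INR X / INR (S d)))))
  <= 18200 * A * Rpower q (3 * alpha) * q ^ 4 * (2 + ln (INR X)) ^ 4.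
Proof.
  intros Hq HX HM HA Ha Hg.
  assert (Hq4 : 1 <= q ^ 4) by (apply pow_R1_Rle; easy).
  assert (HX0 : 1 <= INR X) by (rewrite <- HX; apply pow_R1_Rle; easy).
  assert (HX1 : (1 <= X)%nat) by (destruct X; [simpl in HX0; lra|lia]).
  assert (HlnX := ln_ge0 _ HX0).
  assert (H34 : q ^ 3 <= q ^ 4) by (apply Rle_pow; [easy|lia]).
  assert (H37 : q ^ 3 <= q ^ 7) by (apply Rle_pow; [easy|lia]).
  assert (HMX : (S M <= X)%nat).
  { destruct (Nat.eq_dec M 0) as [->|HM0]; [easy|].
    assert (24 * M <= X)%nat; [|lia].
    apply INR_le. rewrite mult_INR, INR_IZR_INZ. simpl Z.of_nat. lra. }
  set (E := fun d => Dsum (X / d) - divisor_main (INR X / INR d)).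
  set (L := 2 + ln (INR X)). assert (HL : 2 <= L) by (unfold L; lra).
  assert (HE : forall d, (1 <= d <= S M)%nat -> Rabs (E d) <= Rabs (Delta (X / d)) + (L + 1)).
  { intros d Hd. assert (Hd1 : 1 <= INR d) by (apply INR_ge1; lia).
    assert (B := INR_div_bounds X d ltac:(lia)).
    assert (Hu : 1 <= INR (X / d)) by (apply INR_ge1, Nat.div_le_lower_bound; lia).
    assert (S := divisor_main_slope (INR (X / d)) (INR X / INR d) ltac:(lra)).
    assert (ln (INR X / INR d) <= ln (INR X)).
    { apply ln_le; [lra|]. apply Rle_div_l; [lra|]. nra. }
    assert (0 <= ln (INR X / INR d)) by (apply ln_ge0; lra).
    assert ((INR X / INR d - INR (X / d)) * (ln (INR X / INR d) + 3) <= 1 * (L + 1))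
      by (apply Rmult_le_compat; unfold L; lra).
    replace (E d) with (Delta (X / d) + - (divisor_main (INR X / INR d) - divisor_main (INR (X / d))))
      by (unfold E, Delta; ring).
    eapply Rle_trans; [apply Rabs_triang|]. rewrite Rabs_Ropp, (Rabs_right (_ - _)) by lra. lra. }
  assert (HsumE : rsum (S M) (fun d => Rabs (E d)) <= 9100 * q ^ 4 * L ^ 4).
  { eapply Rle_trans; [apply (rsum_le _ _ _ HE)|]. rewrite rsum_plus, rsum_const, S_INR.
    change (rsum (S M) (fun i => Rabs (Delta (X / i))))
      with (rsum M (fun i => Rabs (Delta (X / i))) + Rabs (Delta (X / S M))).
    assert (D := Delta_hyperbolic_sum X M q Hq HX HM). fold L in D.
    assert (T := Delta_trivial_bound (X / S M) ltac:(apply Nat.div_le_lower_bound; lia)).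
    assert (HXM : (X / S M <= X)%nat) by (apply Nat.Div0.div_le_upper_bound; nia).
    assert (T1 := harm_mono _ _ HXM). assert (T2 := harm_le_ln X HX1).
    assert (T3 : INR (Nat.sqrt (X / S M)) <= q ^ 4).
    { apply Rle_trans with (INR (Nat.sqrt X)); [now apply le_INR, Nat.sqrt_le_mono|].
      apply Rsqr_incr_0; [|apply pos_INR|lra]. unfold Rsqr.
      assert (S := INR_sqrt_le X). rewrite <- HX in S.
      assert (q ^ 7 <= q ^ 8) by (apply Rle_pow; [easy|lia]).
      replace (q ^ 4 * q ^ 4) with (q ^ 8) by ring. lra. }
    assert (T4 : (INR M + 1) * (L + 1) <= (2 * q ^ 4) * (2 * L)).
    { assert (0 <= INR M) by apply pos_INR. apply Rmult_le_compat; lra. }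
    assert (HL3 : 8 <= L ^ 3) by (assert (4 <= L ^ 2) by nra; simpl in *; nra).
    assert (HL4 : 8 * L <= L ^ 4) by (replace (L ^ 4) with (L * L ^ 3) by ring; nra).
    assert (U1 : q ^ 4 * (8 * L) <= q ^ 4 * L ^ 4) by (apply Rmult_le_compat_l; lra).
    assert (U2 : 1 * L ^ 4 <= q ^ 4 * L ^ 4) by (apply Rmult_le_compat_r; lra).
    assert (U3 : q ^ 4 * 2 <= q ^ 4 * L) by (apply Rmult_le_compat_l; lra).
    unfold L in *. lra. }
  rewrite <- rsum_minus.
  eapply Rle_trans; [apply rsum_abs|].
  apply Rle_trans with (A * Rpower q (3 * alpha) *
    (rsum M (fun d => Rabs (E d)) + rsum M (fun d => Rabs (E (S d))))).
  - rewrite <- rsum_plus, <- rsum_scal. apply rsum_le; intros d Hd.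
    replace (g d * (Dsum (X / d) - Dsum (X / S d)) - g d * _) with (g d * (E d + - E (S d)))
      by (unfold E; ring).
    rewrite Rabs_mult. apply Rmult_le_compat; try apply Rabs_pos.
    + eapply Rle_trans; [apply Hg; lia|]. apply Rmult_le_compat_l; [easy|].
      rewrite <- Rpower_mult. apply Rle_Rpower_l; [lra|].
      assert (1 <= INR d) by (apply INR_ge1; lia). split; [lra|].
      replace (Rpower q 3) with (q ^ 3).
      * assert (INR d <= INR M) by (apply le_INR; lia). lra.
      * rewrite <- Rpower_pow by lra. f_equal. simpl; ring.
    + eapply Rle_trans; [apply Rabs_triang|]. rewrite Rabs_Ropp. lra.
  - assert (S1 : rsum M (fun d => Rabs (E d)) <= rsum (S M) (fun d => Rabs (E d))).
    { apply rsum_mono; [lia|]. intros; apply Rabs_pos. }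
    assert (S2 : rsum M (fun d => Rabs (E (S d))) <= rsum (S M) (fun d => Rabs (E d))).
    { rewrite rsum_first. assert (P := Rabs_pos (E 1%nat)). lra. }
    replace (18200 * A * Rpower q (3 * alpha) * q ^ 4 * L ^ 4)
      with (A * Rpower q (3 * alpha) * (18200 * q ^ 4 * L ^ 4)) by ring.
    apply Rmult_le_compat_l; [apply Rmult_le_pos; [easy|apply Rpower_ge0]|lra].
Qed.

Definition inv_step (n : nat) : R := / (INR n * INR (S n)).

Definition ln_over_step (n : nat) : R :=
  ln (INR n) / INR n - ln (INR (S n)) / INR (S n).

(** [divisor_main (X/d) = divisor_main X / d - X (ln d) / d]; the differences in [d] are the terms
    of the two series. *)
Lemma divisor_main_quotient_sum (X M : nat) (g : nat -> R) : (1 <= X)%nat ->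
  rsum M (fun d => g d * (divisor_main (INR X / INR d) - divisor_main (INR X / INR (S d))))
  = divisor_main (INR X) * rsum M (fun d => g d * inv_step d)
    - INR X * rsum M (fun d => g d * ln_over_step d).
Proof.
  intros HX. assert (HX1 := INR_ge1 X HX).
  rewrite <- !rsum_scal, <- rsum_minus. apply rsum_ext; intros d Hd.
  assert (Hd1 : 1 <= INR d) by (apply INR_ge1; lia).
  unfold divisor_main, inv_step, ln_over_step. rewrite S_INR.
  rewrite !ln_div by lra. field. lra.
Qed.

Lemma Rpower_plus_le_mono n a d : (1 <= n)%nat -> 0 < d ->
  Rpower (INR n) a * (1 + ln (INR n)) <= (1 + / d) * Rpower (INR n) (a + d).
Proof.
  intros Hn Hd. assert (H1 := INR_ge1 n Hn).
  assert (L := ln_le_Rpower (INR n) d Hd H1). assert (P := Rpower_ge1 (INR n) d H1 ltac:(lra)).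
  rewrite Rpower_plus.
  replace ((1 + / d) * (Rpower (INR n) a * Rpower (INR n) d))
    with (Rpower (INR n) a * ((1 + / d) * Rpower (INR n) d)) by ring.
  apply Rmult_le_compat_l; [apply Rpower_ge0|]. lra.
Qed.

(** The additional exponent [d] absorbs the logarithm in the second series; the first is given the
    same weaker bound so that both share [K]. *)
Lemma step_series_tails (g : nat -> R) A alpha d :
  0 <= A -> 0 <= alpha -> 0 < d -> alpha + d < 1 ->
  (forall n, (1 <= n)%nat -> Rabs (g n) <= A * Rpower (INR n) alpha) ->
  let b := 1 - (alpha + d) in
  let K := 2 * (A * (1 + / d)) / b in
  (ex_series (fun k => g (S k) * inv_step (S k)) /\
   forall M, Rabs (Series (fun k => g (S k) * inv_step (S k)) - rsum M (fun n => g n * inv_step n))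
     <= K * Rpower (INR (S M)) (- b)) /\
  (ex_series (fun k => g (S k) * ln_over_step (S k)) /\
   forall M, Rabs (Series (fun k => g (S k) * ln_over_step (S k))
                   - rsum M (fun n => g n * ln_over_step n))
     <= K * Rpower (INR (S M)) (- b)).
Proof.
  intros HA Ha Hd Had Hg b K.
  assert (Hdi : 0 < / d) by now apply Rinv_0_lt_compat.
  assert (HB : 0 <= A * (1 + / d)) by (apply Rmult_le_pos; lra).
  assert (Hb : 0 < b <= 1) by (unfold b; lra).
  assert (Key : forall n w, (1 <= n)%nat ->
    Rabs w <= (1 + ln (INR n)) / (INR n * INR (S n)) ->
    Rabs (g n * w) <= A * (1 + / d) * (Rpower (INR n) (1 - b) / (INR n * INR (S n)))).
  { intros n w Hn Hw. replace (1 - b) with (alpha + d) by (unfold b; ring).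
    assert (Hi : 0 < / (INR n * INR (S n))).
    { assert (1 <= INR n) by now apply INR_ge1. assert (1 <= INR (S n)) by (apply INR_ge1; lia).
      apply Rinv_0_lt_compat; nra. }
    rewrite Rabs_mult.
    apply Rle_trans with (A * Rpower (INR n) alpha * ((1 + ln (INR n)) / (INR n * INR (S n)))).
    - apply Rmult_le_compat; try apply Rabs_pos; [now apply Hg|easy].
    - assert (P := Rpower_plus_le_mono n alpha d Hn Hd).
      unfold Rdiv. set (w' := / (INR n * INR (S n))) in *.
      replace (A * Rpower (INR n) alpha * ((1 + ln (INR n)) * w'))
        with (A * w' * (Rpower (INR n) alpha * (1 + ln (INR n)))) by ring.
      replace (A * (1 + / d) * (Rpower (INR n) (alpha + d) * w'))
        with (A * w' * ((1 + / d) * Rpower (INR n) (alpha + d))) by ring.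
      apply Rmult_le_compat_l; [apply Rmult_le_pos; lra|easy]. }
  split.
  - apply (series_tail_bound (fun n => g n * inv_step n) _ b HB Hb).
    intros n Hn. apply Key; [easy|]. unfold inv_step.
    assert (H1 := INR_ge1 n Hn). assert (H2 : 1 <= INR (S n)) by (apply INR_ge1; lia).
    assert (Hi : 0 < / (INR n * INR (S n))) by (apply Rinv_0_lt_compat; nra).
    rewrite Rabs_right by lra. assert (HL := ln_ge0 _ H1). unfold Rdiv. nra.
  - apply (series_tail_bound (fun n => g n * ln_over_step n) _ b HB Hb).
    intros n Hn. apply Key; [easy|]. now apply ln_over_n_step.
Qed.

Lemma nfloor_spec t : 0 <= t -> INR (Defs.nfloor t) <= t < INR (Defs.nfloor t) + 1.
Proof.
  intros Ht. unfold Defs.nfloor. destruct (base_Int_part t) as [H1 H2].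
  assert (0 <= Int_part t)%Z.
  { assert (-1 < Int_part t)%Z by (apply lt_IZR; lra). lia. }
  rewrite INR_IZR_INZ, Z2Nat.id by easy. lra.
Qed.

Lemma Rpower_base_scale c t y : 1 <= c -> 0 < t -> 0 <= y <= 1 ->
  Rpower (c * t) y <= c * Rpower t y.
Proof.
  intros Hc Ht Hy. rewrite <- Rpower_mult_distr by lra.
  apply Rmult_le_compat_r; [apply Rpower_ge0|].
  rewrite <- (Rpower_1 c) at 2 by lra. apply Rle_Rpower; lra.
Qed.

Lemma Rpower_nat_mul q n y : 0 < q -> Rpower (q ^ n) y = Rpower q (INR n * y).
Proof. intros Hq. rewrite <- Rpower_pow by easy. apply Rpower_mult. Qed.

(** Three errors of the same order in [q]: small [n] ([24 A]), the divisor error ([18200 A]) and the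
    two series tails ([48 K]). *)
Lemma tau_sum_asymptotic (X : nat) (q A alpha d : R) (g : nat -> R) :
  1 <= q -> q ^ 7 = INR X -> 0 <= A -> 0 <= alpha -> 0 < d -> alpha + d < 1 ->
  (forall n, (1 <= n)%nat -> Rabs (g n) <= A * Rpower (INR n) alpha) ->
  let K := 2 * (A * (1 + / d)) / (1 - (alpha + d)) in
  Rabs (rsum X (fun n => g (X / n)%nat * tau n)
        - (Series (fun k => g (S k) * inv_step (S k)) * divisor_main (INR X)
           - Series (fun k => g (S k) * ln_over_step (S k)) * INR X))
  <= (18224 * A + 48 * K) * Rpower q (4 + 3 * (alpha + d)) * (2 + ln (INR X)) ^ 4.
Proof.
  intros Hq HX HA Ha Hd Had Hg K.
  destruct (step_series_tails g A alpha d HA Ha Hd Had Hg) as [[_ T1] [_ T3]].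
  fold K in T1, T3. set (C1 := Series _) in *. set (C3 := Series (fun k => g (S k) * ln_over_step _)) in *.
  set (b := 1 - (alpha + d)) in *.
  assert (Hb : 0 < b <= 1) by (unfold b; lra).
  assert (HK : 0 <= K).
  { unfold K. fold b. assert (0 < / d) by now apply Rinv_0_lt_compat.
    apply Rmult_le_pos; [|left; apply Rinv_0_lt_compat; lra].
    apply Rmult_le_pos; [lra|]. apply Rmult_le_pos; lra. }
  assert (HX0 : 1 <= INR X) by (rewrite <- HX; apply pow_R1_Rle; easy).
  assert (HX1 : (1 <= X)%nat) by (destruct X; [simpl in HX0; lra|lia]).
  assert (HlnX := ln_ge0 _ HX0).
  set (L := 2 + ln (INR X)). assert (HL : 2 <= L) by (unfold L; lra).
  assert (HL3 : 8 <= L ^ 3) by (assert (4 <= L ^ 2) by nra; simpl in *; nra).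
  assert (HL24 : L ^ 2 <= L ^ 4) by (apply Rle_pow; [lra|lia]).
  assert (HL14 : L <= L ^ 4) by (replace (L ^ 4) with (L * L ^ 3) by ring; nra).
  assert (HL4 : 0 <= L ^ 4) by lra.
  assert (Hq3 : 0 < q ^ 3) by (apply pow_lt; lra).
  assert (Hq4 : 0 < q ^ 4) by (apply pow_lt; lra).
  destruct (nfloor_spec (q ^ 3 / 24) ltac:(lra)) as [HM1 HM2].
  set (M := Defs.nfloor (q ^ 3 / 24)) in *.
  set (e := 4 + 3 * (alpha + d)).
  assert (Hmul : forall u v w, w = u + v -> Rpower q w = Rpower q u * Rpower q v).
  { intros u v w ->. apply Rpower_plus. }
  assert (Hint : forall n : nat, q ^ n = Rpower q (INR n)) by (intros; rewrite Rpower_pow; lra).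
  assert (Hmono : Rpower q (4 + 3 * alpha) <= Rpower q e) by (apply Rle_Rpower; unfold e; lra).
  assert (HSM : q ^ 3 <= 24 * INR (S M)) by (rewrite S_INR; lra).
  assert (HSM1 : 1 <= INR (S M)) by (apply INR_ge1; lia).
  assert (P1 : Rabs (rsum (X / S M) (fun n => g (X / n)%nat * tau n))
    <= 24 * A * Rpower q e * L ^ 4).
  { destruct (Nat.eq_dec (X / S M) 0) as [->|HN].
    { simpl rsum. rewrite Rabs_R0. repeat apply Rmult_le_pos; try apply Rpower_ge0; lra. }
    set (N := (X / S M)%nat) in *.
    assert (HNX : (1 <= N <= X)%nat).
    { split; [lia|]. apply Nat.Div0.div_le_upper_bound; nia. }
    assert (HN24 : INR N <= 24 * q ^ 4).
    { assert (B := INR_div_bounds X (S M) ltac:(lia)). fold N in B.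
      eapply Rle_trans; [apply B|]. apply Rle_div_l; [lra|]. rewrite <- HX.
      replace (q ^ 7) with (q ^ 4 * q ^ 3) by ring. nra. }
    eapply Rle_trans; [apply (sum_small_n_bound X N g A alpha HA ltac:(lra) Hg HNX)|].
    assert (Hh : harm N ^ 2 <= L ^ 2).
    { apply pow_incr. split; [apply harm_ge0|].
      assert (U := harm_mono N X ltac:(lia)). assert (V := harm_le_ln X HX1). unfold L; lra. }
    assert (HNp : Rpower (INR N) (1 - alpha) <= 24 * Rpower q (4 * (1 - alpha))).
    { apply Rle_trans with (Rpower (24 * q ^ 4) (1 - alpha)).
      - apply Rle_Rpower_l; [lra|]. split; [apply lt_0_INR; lia|easy].
      - replace (4 * (1 - alpha)) with (INR 4 * (1 - alpha)) by (simpl; ring). rewrite <- Rpower_nat_mul by lra.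
        apply Rpower_base_scale; lra. }
    assert (HXp : Rpower (INR X) alpha = Rpower q (7 * alpha)).
    { rewrite <- HX, Rpower_nat_mul by lra. f_equal. simpl; ring. }
    rewrite HXp.
    apply Rle_trans with (A * Rpower q (7 * alpha) * (24 * Rpower q (4 * (1 - alpha))) * L ^ 4).
    - apply Rmult_le_compat; [| |apply Rmult_le_compat_l; [|easy]|].
      + repeat apply Rmult_le_pos; try apply Rpower_ge0; easy.
      + apply pow2_ge_0.
      + apply Rmult_le_pos; [easy|apply Rpower_ge0].
      + lra.
    - replace (A * Rpower q (7 * alpha) * (24 * Rpower q (4 * (1 - alpha))) * L ^ 4)
        with (24 * A * (Rpower q (7 * alpha) * Rpower q (4 * (1 - alpha))) * L ^ 4) by ring.
      rewrite <- Rpower_plus. replace (7 * alpha + 4 * (1 - alpha)) with (4 + 3 * alpha) by ring.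
      apply Rmult_le_compat_r; [easy|]. apply Rmult_le_compat_l; [lra|easy]. }
  assert (P2 := quotient_sum_approx X M q A alpha g Hq HX ltac:(lra) HA ltac:(lra) Hg).
  fold L in P2.
  assert (P2' : 18200 * A * Rpower q (3 * alpha) * q ^ 4 * L ^ 4 <= 18200 * A * Rpower q e * L ^ 4).
  { apply Rmult_le_compat_r; [easy|]. rewrite Rmult_assoc.
    apply Rmult_le_compat_l; [lra|]. rewrite Hint, <- Rpower_plus.
    replace (3 * alpha + INR 4) with (4 + 3 * alpha) by (simpl; ring). easy. }
  rewrite divisor_main_quotient_sum in P2 by easy.
  specialize (T1 M). specialize (T3 M).
  set (S1 := rsum M (fun n => g n * inv_step n)) in *.
  set (S3 := rsum M (fun n => g n * ln_over_step n)) in *.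
  set (p := Rpower (INR (S M)) (- b)) in *.
  (* [S M >= q^3/24] and [b <= 1] give [p <= 24 q^(-3b)], and [7 - 3b = e]. *)
  assert (Hp : INR X * p <= 24 * Rpower q e).
  { assert (Hp24 : Rpower q (3 * b) * p <= 24).
    { unfold p. rewrite Rpower_Ropp. apply Rle_div_l; [apply exp_pos|].
      replace (3 * b) with (INR 3 * b) by (simpl; ring). rewrite <- Rpower_nat_mul by lra.
      eapply Rle_trans; [|apply Rpower_base_scale; lra].
      apply Rle_Rpower_l; [lra|easy]. }
    rewrite <- HX, Hint, (Hmul e (3 * b)) by (unfold e, b; simpl; ring).
    rewrite Rmult_assoc, (Rmult_comm 24). apply Rmult_le_compat_l; [apply Rpower_ge0|easy]. }
  assert (Hp0 : 0 <= p) by apply Rpower_ge0.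
  assert (HPX : 0 <= divisor_main (INR X) <= INR X * L).
  { assert (G := euler_gamma_bounds). unfold divisor_main, L. split.
    - assert (0 <= INR X * ln (INR X)) by (apply Rmult_le_pos; lra).
      assert (0 <= (2 * euler_gamma - 1) * INR X) by (apply Rmult_le_pos; lra). lra.
    - nra. }
  assert (P3 : Rabs (divisor_main (INR X) * (C1 - S1) - INR X * (C3 - S3))
    <= 48 * K * Rpower q e * L ^ 4).
  { unfold Rminus at 1. eapply Rle_trans; [apply Rabs_triang|].
    rewrite Rabs_Ropp, !Rabs_mult, !(Rabs_right (INR X)), (Rabs_right (divisor_main _)) by lra.
    assert (Q1 : divisor_main (INR X) * Rabs (C1 - S1) <= INR X * L * (K * p))
      by (apply Rmult_le_compat; try apply Rabs_pos; lra).
    assert (Q2 : INR X * Rabs (C3 - S3) <= INR X * (K * p))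
      by (apply Rmult_le_compat_l; lra).
    assert (HKp : 0 <= K * (INR X * p)) by (apply Rmult_le_pos; [exact HK|apply Rmult_le_pos; lra]).
    apply Rle_trans with (2 * (K * (INR X * p)) * L ^ 4).
    - assert (K * (INR X * p) * L <= K * (INR X * p) * L ^ 4) by (apply Rmult_le_compat_l; lra).
      assert (K * (INR X * p) * 1 <= K * (INR X * p) * L ^ 4) by (apply Rmult_le_compat_l; lra).
      lra.
    - apply Rmult_le_compat_r; [easy|].
      assert (K * (INR X * p) <= K * (24 * Rpower q e)) by (apply Rmult_le_compat_l; easy). lra. }
  rewrite (sum_by_quotient X M).
  set (U := rsum (X / S M) _) in *. set (V := rsum M (fun d0 => g d0 * (Dsum _ - _))) in *.
  replace (U + V - (C1 * divisor_main (INR X) - C3 * INR X))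
    with (U + (V - (divisor_main (INR X) * S1 - INR X * S3))
          + - (divisor_main (INR X) * (C1 - S1) - INR X * (C3 - S3))) by ring.
  eapply Rle_trans; [apply Rabs_triang|]. rewrite Rabs_Ropp.
  eapply Rle_trans; [apply Rplus_le_compat; [apply Rabs_triang|apply P3]|]. lra.
Qed.

Lemma log_power_absorb d : 0 < d ->
  exists K, 0 <= K /\ forall q, 1 <= q -> (2 + 7 * ln q) ^ 4 <= K * Rpower q (4 * d).
Proof.
  intros Hd. assert (Hi : 0 < / d) by now apply Rinv_0_lt_compat.
  exists ((2 + 7 * / d) ^ 4). split; [apply pow_le; lra|]. intros q Hq.
  assert (H1 := ln_le_Rpower q d Hd Hq). assert (H2 := Rpower_ge1 q d Hq ltac:(lra)).
  assert (H3 := ln_ge0 q Hq).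
  replace (Rpower q (4 * d)) with (Rpower q d ^ 4).
  - rewrite <- Rpow_mult_distr. apply pow_incr. lra.
  - rewrite <- Rpower_pow by apply exp_pos. rewrite Rpower_mult. f_equal. simpl; ring.
Qed.

Definition T_real (g : nat -> R) (X : nat) : R :=
  rsum X (fun a => rsum (X / a) (fun b => g (X / (a * b))%nat)).

Lemma T_real_asymptotic (g : nat -> R) A alpha :
  0 <= alpha < 1 -> 0 <= A ->
  (forall n, (1 <= n)%nat -> Rabs (g n) <= A * Rpower (INR n) alpha) ->
  exists C1 C3,
    is_series (fun k => g (S k) * inv_step (S k)) C1 /\
    is_series (fun k => g (S k) * ln_over_step (S k)) C3 /\
    forall eps, 0 < eps -> exists K, 0 <= K /\ forall x, 2 <= x ->
      Rabs (T_real g (Defs.nfloor x) - (C1 * divisor_main x - C3 * x))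
      <= K * Rpower x ((4 + 3 * alpha) / 7 + eps).
Proof.
  intros Ha HA Hg.
  exists (Series (fun k => g (S k) * inv_step (S k))), (Series (fun k => g (S k) * ln_over_step (S k))).
  (* Any admissible exponent proves convergence; it is fixed here because the sums must not depend
     on [eps]. *)
  destruct (step_series_tails g A alpha ((1 - alpha) / 2) HA ltac:(lra) ltac:(lra) ltac:(lra) Hg)
    as [[E1 _] [E3 _]].
  split; [now apply Series_correct|]. split; [now apply Series_correct|].
  intros eps Heps.
  set (C1 := Series _). set (C3 := Series (fun k => g (S k) * ln_over_step _)).
  (* The second entry keeps [alpha + d < 1] when [eps] is large. *)
  set (d := Rmin eps ((1 - alpha) / 2)).
  assert (Hd : 0 < d /\ d <= eps /\ d <= (1 - alpha) / 2).
  { unfold d. split; [apply Rmin_glb_lt; lra|]. split; [apply Rmin_l|apply Rmin_r]. }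
  destruct Hd as (Hd0 & Hd1 & Hd2).
  destruct (log_power_absorb d Hd0) as (K4 & HK4 & Hlog).
  set (K := 2 * (A * (1 + / d)) / (1 - (alpha + d))).
  assert (HK : 0 <= K).
  { assert (0 < / d) by now apply Rinv_0_lt_compat.
    apply Rmult_le_pos; [|left; apply Rinv_0_lt_compat; lra].
    apply Rmult_le_pos; [lra|]. apply Rmult_le_pos; lra. }
  set (K0 := 18224 * A + 48 * K). assert (HK0 : 0 <= K0) by (unfold K0; lra).
  set (th := (4 + 3 * alpha) / 7 + eps).
  assert (Hth : 0 < th) by (unfold th; lra).
  set (K1 := Rabs C1 * (/ th + 3) + Rabs C3).
  assert (Hthi : 0 < / th) by now apply Rinv_0_lt_compat.
  assert (HK1 : 0 <= K1).
  { unfold K1. assert (P := Rabs_pos C1). assert (P' := Rabs_pos C3). nra. }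
  exists (K0 * K4 + K1). split; [nra|]. intros x Hx.
  destruct (nfloor_spec x ltac:(lra)) as [Hf1 Hf2]. set (X := Defs.nfloor x) in *.
  assert (HX1 : 1 <= INR X) by lra.
  set (q := Rpower (INR X) (/ 7)).
  assert (Hq : 1 <= q) by (apply Rpower_ge1; lra).
  assert (HqX : q ^ 7 = INR X).
  { unfold q. rewrite <- Rpower_pow by apply exp_pos. rewrite Rpower_mult.
    replace (/ 7 * INR 7) with 1 by (simpl; field). apply Rpower_1; lra. }
  assert (HlnX : ln (INR X) = 7 * ln q).
  { rewrite <- HqX, ln_pow by lra. f_equal. simpl; ring. }
  assert (B := tau_sum_asymptotic X q A alpha d g Hq HqX HA ltac:(lra) Hd0 ltac:(lra) Hg).
  fold K in B. cbv zeta in B. fold C1 C3 K0 in B. rewrite HlnX in B.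
  assert (B1 : K0 * Rpower q (4 + 3 * (alpha + d)) * (2 + 7 * ln q) ^ 4 <= K0 * K4 * Rpower x th).
  { apply Rle_trans with (K0 * Rpower q (4 + 3 * (alpha + d)) * (K4 * Rpower q (4 * d))).
    - apply Rmult_le_compat_l; [apply Rmult_le_pos; [easy|apply Rpower_ge0]|now apply Hlog].
    - replace (K0 * Rpower q (4 + 3 * (alpha + d)) * (K4 * Rpower q (4 * d)))
        with (K0 * K4 * (Rpower q (4 + 3 * (alpha + d)) * Rpower q (4 * d))) by ring.
      apply Rmult_le_compat_l; [nra|]. rewrite <- Rpower_plus.
      (* The tails lose [q^(3d)] and the logarithms [q^(4d)], together [q^(7d) <= q^(7 eps)]. *)
      apply Rle_trans with (Rpower q (7 * th)); [apply Rle_Rpower; unfold th; lra|].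
      replace 7 with (INR 7) by (simpl; ring). rewrite <- Rpower_nat_mul, HqX by lra.
      apply Rle_Rpower_l; lra. }
  (* Return from [X] to [x]: the main terms move by [O(1 + ln x)], which [x^th] absorbs. *)
  assert (S := divisor_main_slope (INR X) x ltac:(lra)).
  assert (Hlx := ln_ge0 x ltac:(lra)). assert (Hlx' := ln_le_Rpower x th Hth ltac:(lra)).
  assert (Hx1 := Rpower_ge1 x th ltac:(lra) ltac:(lra)).
  assert (S' : divisor_main x - divisor_main (INR X) <= (/ th + 3) * Rpower x th).
  { assert ((x - INR X) * (ln x + 3) <= 1 * (ln x + 3)) by (apply Rmult_le_compat_r; lra). lra. }
  assert (B2 : Rabs (C1 * (divisor_main x - divisor_main (INR X)) - C3 * (x - INR X))
    <= K1 * Rpower x th).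
  { unfold Rminus at 1. eapply Rle_trans; [apply Rabs_triang|].
    rewrite Rabs_Ropp, !Rabs_mult, (Rabs_right (divisor_main x - _)), (Rabs_right (x - _)) by lra.
    unfold K1. assert (P := Rabs_pos C1). assert (P' := Rabs_pos C3).
    assert (Rabs C1 * (divisor_main x - divisor_main (INR X)) <= Rabs C1 * ((/ th + 3) * Rpower x th))
      by (apply Rmult_le_compat_l; lra).
    assert (Rabs C3 * (x - INR X) <= Rabs C3 * Rpower x th) by (apply Rmult_le_compat_l; lra).
    lra. }
  assert (HT : T_real g X = rsum X (fun n => g (X / n)%nat * tau n))
    by apply (sum_pairs_tau X (fun n => g (X / n)%nat)).
  rewrite HT. set (W := rsum X _) in *.
  replace (W - (C1 * divisor_main x - C3 * x))
    with (W - (C1 * divisor_main (INR X) - C3 * INR X)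
          + - (C1 * (divisor_main x - divisor_main (INR X)) - C3 * (x - INR X))) by ring.
  eapply Rle_trans; [apply Rabs_triang|]. rewrite Rabs_Ropp.
  fold th. lra.
Qed.

(** * Real and imaginary parts, and reduction to the integer part of [x] *)

Lemma csum_re n F : Re (csum 1 n F) = rsum n (fun i => Re (F i)).
Proof.
  unfold csum. enough (H : forall lo, Re (fold_right Cplus (RtoC 0) (map F (seq lo n)))
    = rsum n (fun i => Re (F (lo + i - 1)%nat))).
  { rewrite H. apply rsum_ext; intros i _. do 2 f_equal. lia. }
  induction n as [|n IH]; intros lo; [easy|].
  rewrite rsum_first. simpl seq. simpl map. simpl fold_right.
  change (Re (Cplus ?u ?v)) with (Re u + Re v). rewrite IH.
  replace (lo + 1 - 1)%nat with lo by lia. f_equal.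
  apply rsum_ext; intros i _. do 2 f_equal. lia.
Qed.

Lemma csum_im n F : Im (csum 1 n F) = rsum n (fun i => Im (F i)).
Proof.
  unfold csum. enough (H : forall lo, Im (fold_right Cplus (RtoC 0) (map F (seq lo n)))
    = rsum n (fun i => Im (F (lo + i - 1)%nat))).
  { rewrite H. apply rsum_ext; intros i _. do 2 f_equal. lia. }
  induction n as [|n IH]; intros lo; [easy|].
  rewrite rsum_first. simpl seq. simpl map. simpl fold_right.
  change (Im (Cplus ?u ?v)) with (Im u + Im v). rewrite IH.
  replace (lo + 1 - 1)%nat with lo by lia. f_equal.
  apply rsum_ext; intros i _. do 2 f_equal. lia.
Qed.

(** An integer multiple of [n] is at most [x] exactly when it is at most the integer part of [x].
    This turns all real quotients in [T_f] into natural-number division. *)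
Lemma nfloor_div x n : 0 <= x -> (1 <= n)%nat ->
  Defs.nfloor (x / INR n) = (Defs.nfloor x / n)%nat.
Proof.
  intros Hx Hn. assert (Hn1 := INR_ge1 n Hn).
  assert (Hq : 0 <= x / INR n) by (apply Rmult_le_pos; [easy|left; apply Rinv_0_lt_compat; lra]).
  destruct (nfloor_spec x Hx) as [A1 A2]. destruct (nfloor_spec _ Hq) as [B1 B2].
  set (X := Defs.nfloor x) in *. set (k := Defs.nfloor (x / INR n)) in *.
  apply Rle_div_r in B1; [|lra]. apply Rlt_div_l in B2; [|lra].
  assert (C1 : (k * n < X + 1)%nat).
  { apply INR_lt. rewrite mult_INR, plus_INR. simpl. lra. }
  assert (C2 : (X < (k + 1) * n)%nat).
  { apply INR_lt. rewrite mult_INR, plus_INR. simpl. lra. }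
  apply (Nat.div_unique X n k (X - n * k)); nia.
Qed.

Lemma T_f_re f x : 0 <= x -> Re (T_f f x) = T_real (fun n => Re (f n)) (Defs.nfloor x).
Proof.
  intros Hx. unfold T_f, T_real. rewrite csum_re. apply rsum_ext; intros a Ha.
  rewrite csum_re, nfloor_div by (easy || lia). apply rsum_ext; intros b Hb.
  rewrite <- mult_INR, nfloor_div by (easy || nia). easy.
Qed.

Lemma T_f_im f x : 0 <= x -> Im (T_f f x) = T_real (fun n => Im (f n)) (Defs.nfloor x).
Proof.
  intros Hx. unfold T_f, T_real. rewrite csum_im. apply rsum_ext; intros a Ha.
  rewrite csum_im, nfloor_div by (easy || lia). apply rsum_ext; intros b Hb.
  rewrite <- mult_INR, nfloor_div by (easy || nia). easy.
Qed.

Lemma Cmod_le_Re_Im (z : C) : Cmod z <= Rabs (Re z) + Rabs (Im z).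
Proof.
  replace z with (Cplus (RtoC (Re z)) (Cmult Ci (RtoC (Im z)))) at 1.
  - eapply Rle_trans; [apply Cmod_triangle|]. rewrite Cmod_mult, Cmod_Ci, !Cmod_R. lra.
  - destruct z. unfold Cplus, Cmult, Ci, RtoC; simpl. f_equal; ring.
Qed.

Lemma Re_mult_RtoC (z : C) r : Re (Cmult z (RtoC r)) = Re z * r.
Proof. destruct z. unfold Cmult, RtoC, Re; simpl; ring. Qed.

Lemma Im_mult_RtoC (z : C) r : Im (Cmult z (RtoC r)) = Im z * r.
Proof. destruct z. unfold Cmult, RtoC, Im; simpl; ring. Qed.

Lemma is_series_C_components (a : nat -> C) (u v : R) :
  is_series (fun k => Re (a k)) u -> is_series (fun k => Im (a k)) v -> is_series a ((u, v) : C).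
Proof.
  intros Hu Hv.
  assert (E : forall n, sum_n a n
    = (sum_n (fun k => Re (a k)) n, sum_n (fun k => Im (a k)) n) :> C).
  { induction n as [|n IH]; [rewrite !sum_O; now destruct (a 0%nat)|].
    rewrite !sum_Sn, IH. now destruct (a (S n)). }
  apply (filterlim_locally (sum_n a) ((u, v) : C)). intros eps.
  assert (A := proj1 (filterlim_locally _ _) Hu eps).
  assert (B := proj1 (filterlim_locally _ _) Hv eps).
  generalize (filter_and _ _ A B). apply filter_imp. intros n [H1 H2].
  rewrite E. split; easy.
Qed.
Theorem theorem1 (f : nat -> C) (alpha : R) :
  0 <= alpha < 1 ->
  (exists A : R, forall n : nat, (1 <= n)%nat -> Cmod (f n) <= A * Rpower (INR n) alpha) ->
  exists C1 C3 : C,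
    (* C1 = sum_{d>=1} f(d)/(d(d+1)) ; index shift d = k+1 *)
    is_series (fun k : nat => Cdiv (f (S k)) (RtoC (INR (S k) * INR (S (S k))))) C1 /\
    (* C3 = sum_{d>=1} f(d) (log d / d - log(d+1)/(d+1)) *)
    is_series (fun k : nat => Cmult (f (S k))
        (RtoC (ln (INR (S k)) / INR (S k) - ln (INR (S (S k))) / INR (S (S k))))) C3 /\
    forall eps : R, 0 < eps ->
      exists K : R, forall x : R, 2 <= x ->
        Cmod (Cminus (T_f f x)
               (Cplus (Cmult C1 (RtoC (x * ln x)))
                      (Cmult (Cminus (Cmult (RtoC (2 * euler_gamma - 1)) C1) C3) (RtoC x))))
        <= K * Rpower x ((4 + 3 * alpha) / 7 + eps).
Proof.
  intros Ha [A HA].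
  assert (HA0 : 0 <= A).
  { assert (H := HA 1%nat (le_n 1)). assert (P := Cmod_ge_0 (f 1%nat)).
    simpl in H. unfold Rpower in H. rewrite ln_1, Rmult_0_r, exp_0 in H. lra. }
  assert (Hre : forall n, (1 <= n)%nat -> Rabs (Re (f n)) <= A * Rpower (INR n) alpha).
  { intros n Hn. eapply Rle_trans; [|apply HA; easy].
    eapply Rle_trans; [apply Rmax_l|apply Rmax_Cmod]. }
  assert (Him : forall n, (1 <= n)%nat -> Rabs (Im (f n)) <= A * Rpower (INR n) alpha).
  { intros n Hn. eapply Rle_trans; [|apply HA; easy].
    eapply Rle_trans; [apply Rmax_r|apply Rmax_Cmod]. }
  destruct (T_real_asymptotic _ A alpha Ha HA0 Hre) as (u1 & u3 & Hu1 & Hu3 & Hu).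
  destruct (T_real_asymptotic _ A alpha Ha HA0 Him) as (v1 & v3 & Hv1 & Hv3 & Hv).
  exists (u1, v1), (u3, v3). split; [|split].
  - apply is_series_C_components.
    + eapply is_series_ext; [|apply Hu1]. intros k. unfold inv_step.
      assert (1 <= INR (S k)) by (apply INR_ge1; lia).
      assert (1 <= INR (S (S k))) by (apply INR_ge1; lia).
      unfold Cdiv. rewrite <- RtoC_inv by nra. rewrite Re_mult_RtoC. easy.
    + eapply is_series_ext; [|apply Hv1]. intros k. unfold inv_step.
      assert (1 <= INR (S k)) by (apply INR_ge1; lia).
      assert (1 <= INR (S (S k))) by (apply INR_ge1; lia).
      unfold Cdiv. rewrite <- RtoC_inv by nra. rewrite Im_mult_RtoC. easy.
  - apply is_series_C_components.
    + eapply is_series_ext; [|apply Hu3]. intros k. unfold ln_over_step. now rewrite Re_mult_RtoC.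
    + eapply is_series_ext; [|apply Hv3]. intros k. unfold ln_over_step. now rewrite Im_mult_RtoC.
  - intros eps Heps. destruct (Hu eps Heps) as (K1 & _ & B1). destruct (Hv eps Heps) as (K2 & _ & B2).
    exists (K1 + K2). intros x Hx.
    specialize (B1 x Hx). specialize (B2 x Hx).
    rewrite <- T_f_re in B1 by lra. rewrite <- T_f_im in B2 by lra.
    eapply Rle_trans; [apply Cmod_le_Re_Im|]. rewrite Rmult_plus_distr_r.
    apply Rplus_le_compat; [eapply Rle_trans; [|apply B1]|eapply Rle_trans; [|apply B2]];
      apply Req_le; f_equal; unfold divisor_main;
      destruct (T_f f x) as [t1 t2]; unfold Cminus, Cplus, Copp, Cmult, RtoC, Re, Im; simpl; ring.
Qed.
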